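(* Let $\mathcal A=\{h_1,\dots,h_6\}$ be the arrangement in $\mathbb R^3$ of the planes spanned by the faces of a pyramid with a regular pentagonal base, where $h_6$ is the plane of the base and $h_1,\dots,h_5$ are the planes of the side faces in cyclic order, and let $V_q=V_q(\mathcal A)$ be its $38\times38$ $q$-Varchenko matrix, with the regions ordered as in the context. Then the Smith normal form of $V_q$ over $\mathbb Z[q]$ is $$\mathrm{diag}\big(1,\ (1-q^2)I_6,\ (1-q^2)^2I_{15},\ (1-q^2)^3I_{13},\ (1-q^2)^2(1-q^{10})I_3\big),$$ with left transition matrix $WLTP$ and right transition matrix $(TP)^tRW^t$, where the matrices are as follows. $$P=\begin{pmatrix}I_{16}&-qI_{16}&0\\ 0&I_{16}&0\\ 0&0&I_6\end{pmatrix},\qquad P\,V_q(\mathcal A)\,P^t=\begin{pmatrix}(1-q^2)V_q(\mathcal A^{h_6})&0\\ 0&V_q(\mathcal A-\{h_6\})\end{pmatrix},$$ where $V_q(\mathcal A^{h_6})$ is the $16\times 16$ $q$-Varchenko matrix of the arrangement of the five lines spanned by the edges of a regular pentagon, and $$V_q(\mathcal A-\{h_6\})=\begin{pmatrix}1&Q_1&Q_2&Q_3&Q_4&q^5\\ Q_1^t&v_{11}&v_{12}&v_{13}&v_{14}&Q_4^t\\ Q_2^t&v_{21}&v_{22}&v_{23}&v_{24}&Q_3^t\\ Q_3^t&v_{31}&v_{32}&v_{33}&v_{34}&Q_2^t\\ Q_4^t&v_{41}&v_{42}&v_{43}&v_{44}&Q_1^t\\ q^5&Q_4&Q_3&Q_2&Q_1&1\end{pmatrix},$$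 with $Q_k=(q^k,q^k,q^k,q^k,q^k)$, $v_{ji}=v_{ij}^t$, $v_{11}=v_{44}=C(1,q^2,q^2,q^2,q^2)$, $v_{12}=v_{34}=C(q,q^3,q^3,q^3,q)$, $v_{13}=v_{24}=C(q^2,q^4,q^4,q^2,q^2)$, $v_{14}=C(q^3,q^5,q^3,q^3,q^3)$, $v_{22}=v_{33}=C(1,q^2,q^4,q^4,q^2)$, $v_{23}=C(q,q^3,q^5,q^3,q)$, where $C(a_1,\dots,a_5)$ is the $5\times5$ circulant matrix with first row $(a_1,\dots,a_5)$, each row being the previous one cyclically shifted one step to the right. $$T=\begin{pmatrix}1&0&0&0&0\\ -q\mathbf 1&I_5&0&0&0\\ q^2\mathbf 1&-q(I+J)&I_5&0&0\\ 0&q^2J^2&-q(I+J)&I_5&0\\ 0&0&0&0&U_2U_1\end{pmatrix}\ (\text{block sizes }1,5,5,5,22),$$ $$U_1=\begin{pmatrix}1&0&0&0&0&0\\ -q\mathbf 1&I_5&0&0&0&0\\ q^2\mathbf 1&-q(I+J)&I_5&0&0&0\\ 0&q^2J&-q(I+J)&I_5&0&0\\ 0&-q^5J^t&q^2J+q^4(J^3+J^t)&-q(I+J)-q^3J^3&I_5&0\\ -q^5&u_{51}&u_{52}&u_{53}&u_{54}&1\end{pmatrix}\ (\text{block sizes }1,5,5,5,5,1),$$ $u_{51}=(q^4,0,0,0,q^4)$, $u_{52}=(0,0,0,0,-q^3)$, $u_{53}=(0,q^2,0,0,0)$, $u_{54}=(-q,-q,0,0,0)$; $U_2$ is the $22\times22$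 matrix (same block sizes $1,5,5,5,5,1$) with identity diagonal blocks whose only nonzero off-diagonal block is the block in the last block row and fourth block column, equal to $u=(0,0,0,-q^2(1-q^2),-q^2(1-q^2))$; $L=\begin{pmatrix}I_{32}&0\\ 0&L_0\end{pmatrix}$ and $R=\begin{pmatrix}I_{32}&0\\ 0&R_0\end{pmatrix}$, with $$L_0=\left(\begin{array}{cccccc} 1&0&-1&-q^2&0&0\\ 0&1&0&0&-(1+q^2)&0\\ 0&q^2&1&-(1+q^4-q^8)&-q^2(1+q^2)&-q(1-q^4)\\ 0&-q^3&-q&-q(1-q^2-q^4+q^8)&q^3(1+q^2)&1+q^2-q^6\\ 0&-q^2(1+q^2)&-q^2&q^2(1-q^6-q^8)&1+2q^2+2q^4+q^6&-q^5(1+q^2)\\ -q^2&-2q^2&0&1+q^2-q^8&1+q^2+q^4&-q(1+q^4) \end{array}\right),$$ and $$R_0=\left(\begin{array}{cccccc} 1&q^4&1+q^4+q^6+q^8&\alpha&-(1-2q^2-2q^8-q^{10})&1-q^2+q^6\\ 0&1&q^2(1+q^2)&\beta&1+q^2+q^4+q^6&-q^2(1+q^2)\\ 0&0&1&q(1+q^6)&-(1-q^4)&1+q^2\\ 0&0&0&0&-1&1+q^2\\ 0&0&0&-q(1-q^2)&1-q^2&q^2\\ 0&0&0&1&q&-q(2+q^2) \end{array}\right),$$ $\alpha=q(2+2q^4+3q^6+q^8+2q^{10}+2q^{12}+q^{14})$, $\beta=q^3(2+q^2+q^4+2q^6+q^8)$; $$W=\begin{pmatrix}0&0&0&1&0&0&0&0\\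 1&0&0&0&0&0&0&0\\ 0&0&0&0&I_5&0&0&0\\ 0&I_5&0&0&0&0&0&0\\ 0&0&0&0&0&I_{10}&0&0\\ 0&0&I_{10}&0&0&0&0&0\\ 0&0&0&0&0&0&I_3&0\\ 0&0&0&0&0&0&0&I_3\end{pmatrix}\ (\text{column block sizes }1,5,10,1,5,10,3,3).$$ Here $\mathbf 1$ is the $5\times1$ column of ones, $I=I_5$, and $J$ is the $5\times5$ permutation matrix with $J_{r,r+1}=1$ for $1\le r\le4$, $J_{5,1}=1$ and all other entries $0$.
   Context: For a hyperplane arrangement, the regions are the connected components of the complement of the union of the hyperplanes; $sep(R,R')$ is the set of hyperplanes separating $R$ from $R'$. The $q$-Varchenko matrix $V_q$ is indexed by the regions, with $(R,R')$-entry $q^{\#sep(R,R')}$. For a hyperplane $h\in\mathcal A$, $\mathcal A^{h}$ is the arrangement in $h$ consisting of the nonempty intersections $h\cap h'$ with $h'\in\mathcal A-\{h\}$. $R_0$ is the interior of the pyramid. A region $R$ is denoted by the string of indices of the planes in $sep(R_0,R)$ (with $0$ denoting $R_0$). The 38 regions, in order, are: first the sixteen regions on the side of $h_6$ not containing $R_0$: $6$; $16,26,36,46,56$; $126,236,346,456,156$; $1236,2346,3456,1456,1256$; then the twenty-two regions on the same side of $h_6$ as $R_0$: $0$; $1,2,3,4,5$; $12,23,34,45,15$; $123,234,345,145,125$; $1234,2345,1345,1245,1235$; $12345$. The rows and columns of $V_q(\mathcal A-\{h_6\})$ are indexed by the last twenty-two strings in this order, and those of $V_q(\mathcal A^{h_6})$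 by the first sixteen of these twenty-two. A Smith normal form over $\mathbb Z[q]$ of an $m\times m$ matrix $M$ over $\mathbb Z[q]$ is a diagonal matrix $D=\mathrm{diag}(d_1,\dots,d_m)$ with $d_k\mid d_{k+1}$ in $\mathbb Z[q]$ for all $k$ and $D=AMB$ with $A,B\in GL_m(\mathbb Z[q])$; $A$ and $B$ are the left and right transition matrices.
   Formalization: Three misprinted entries are corrected: block (4,2) of T is q^2 J, not q^2 J^2; entry (4,4) of L_0 is -q(-1-q^2-q^4+q^8); entry (5,5) of L_0 is 1+q^2+2q^4+q^6. As printed, the product is not diagonal and det L_0 is not a unit of Z[q]. *)

(* Defs.v *)
From HB Require Import structures.
From mathcomp Require Import all_boot all_order all_algebra.
From mathcomp Require Import finmap.
From mathcomp Require Import all_classical all_reals all_analysis.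
Set Implicit Arguments.
Unset Strict Implicit.
Unset Printing Implicit Defensive.
Import Order.TTheory GRing.Theory Num.Theory.
Import numFieldNormedType.Exports.
Local Open Scope classical_set_scope.
Local Open Scope ring_scope.

Section Arrangements.
Variables (R : realType) (d : nat).
Implicit Types (E H C : set 'rV[R]_d) (A : set (set 'rV[R]_d)).

Definition dot (u v : 'rV[R]_d) : R := (u *m v^T) 0 0.

Definition affine_hull (S : set 'rV[R]_d) : set 'rV[R]_d :=
  [set x | exists (n : nat) (t : 'I_n -> R) (p : 'I_n -> 'rV[R]_d),
    [/\ forall i, S (p i), \sum_i t i = 1 & x = \sum_i t i *: p i]].

Definition convex_hull (S : set 'rV[R]_d) : set 'rV[R]_d :=
  [set x | exists (n : nat) (t : 'I_n -> R) (p : 'I_n -> 'rV[R]_d),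
    [/\ forall i, S (p i), forall i, 0 <= t i,
        \sum_i t i = 1 & x = \sum_i t i *: p i]].

(* An arrangement is a set [A] of hyperplanes of an ambient affine space [E],  *)
(* itself a subset of 'rV[R]_d: [E] is [setT], or a hyperplane h for A^h.      *)

Definition arr_complement E A : set 'rV[R]_d := E `\` \bigcup_(H in A) H.

Definition regions E A : set (set 'rV[R]_d) :=
  [set C | exists2 x, arr_complement E A x &
                      C = connected_component (arr_complement E A) x].

(* [C] and [C'] lie in the two opposite open half-spaces of [E] bounded by [H] *)
Definition separates E H C C' : Prop :=
  exists (a : 'rV[R]_d) (c : R),
    [/\ H = E `&` [set x | dot a x = c],
        C `<=` [set x | dot a x < c] & C' `<=` [set x | c < dot a x]].

Definition sep E A C C' : set (set 'rV[R]_d) :=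
  [set H | A H /\ separates E H C C'].

Definition arr_restriction A H : set (set 'rV[R]_d) :=
  [set H `&` H' | H' in A `\ H] `\ set0.

(* The q-Varchenko matrix, q being 'X, for the ordering [r] of the regions.    *)
(* [fset_set] is meaningful on finite sets: arrangements are finite here.      *)
Definition varchenko E A m (r : 'I_m -> set 'rV[R]_d) : 'M[{poly int}]_m :=
  \matrix_(i, j) 'X ^+ #|` fset_set (sep E A (r i) (r j))|.

(* [r] lists the regions without repetition, the k-th one being separated from *)
(* the base set [B] by exactly the hyperplanes whose indices (through the      *)
(* numbering [h]) occur in the k-th string of [ss].                            *)
Definition region_ordering E A (h : nat -> set 'rV[R]_d) B
    (ss : seq (seq nat)) m (r : 'I_m -> set 'rV[R]_d) : Prop :=
  set_bij [set: 'I_m] (regions E A) r /\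
  forall k : 'I_m, sep E A B (r k) = [set h i | i in [set` nth [::] ss k]].

End Arrangements.

Section Pyramid.
Variable R : realType.
Implicit Types (a : 'rV[R]_3) (v : 'I_5 -> 'rV[R]_3).

(* [v] lists the vertices of a regular pentagon in cyclic order *)
Definition regular_pentagon v : Prop :=
  exists (c e1 e2 : 'rV[R]_3) (rho : R),
    [/\ 0 < rho, dot e1 e1 = 1, dot e2 e2 = 1, dot e1 e2 = 0 &
        forall k : 'I_5,
          v k = c + (rho * cos (2 * pi * k%:R / 5)) *: e1
                  + (rho * sin (2 * pi * k%:R / 5)) *: e2].

(* The i-th edge (1 <= i <= 5) of the base joins [v (i - 1)] to [v (i mod 5)] *)
Definition base_edge v (i : nat) : set 'rV[R]_3 :=
  [set v (inord i.-1); v (inord (i %% 5))].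

Definition base_plane v : set 'rV[R]_3 := affine_hull (range v).

(* h_1, ..., h_5 contain the side faces of the pyramid with apex [a], h_6 its  *)
(* base; only the indices from 1 to 6 are meaningful.                          *)
Definition pyramid_plane a v (i : nat) : set 'rV[R]_3 :=
  if i == 6%N then base_plane v else affine_hull (a |` base_edge v i).

Definition pyramid_arr a v : set (set 'rV[R]_3) :=
  [set pyramid_plane a v i | i in [set i | (1 <= i <= 6)%N]].

Definition pyramid_interior a v : set 'rV[R]_3 :=
  (convex_hull (a |` range v))°.

(* The arrangement, in the plane of the pentagon, of the lines of its edges    *)
Definition pentagon_arr v : set (set 'rV[R]_3) :=
  [set affine_hull (base_edge v i) | i in [set i | (1 <= i <= 5)%N]].

Definition pentagon_interior v : set 'rV[R]_3 :=
  convex_hull (range v) `\` \bigcup_(l in pentagon_arr v) l.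

End Pyramid.

Definition strings16 : seq (seq nat) :=
  [:: [::];
      [:: 1]; [:: 2]; [:: 3]; [:: 4]; [:: 5];
      [:: 1; 2]; [:: 2; 3]; [:: 3; 4]; [:: 4; 5]; [:: 1; 5];
      [:: 1; 2; 3]; [:: 2; 3; 4]; [:: 3; 4; 5]; [:: 1; 4; 5]; [:: 1; 2; 5]]%N.

Definition strings22 : seq (seq nat) :=
  strings16 ++
  [:: [:: 1; 2; 3; 4]; [:: 2; 3; 4; 5]; [:: 1; 3; 4; 5]; [:: 1; 2; 4; 5];
      [:: 1; 2; 3; 5];
      [:: 1; 2; 3; 4; 5]]%N.

Definition strings38 : seq (seq nat) :=
  [seq rcons s 6%N | s <- strings16] ++ strings22.

(* The library's [%|] on polynomials is a pseudo-divisibility, which ignores   *)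
(* nonzero integer factors, hence the explicit cofactor.                       *)
Definition is_smith_normal_form m (M D A B : 'M[{poly int}]_m) : Prop :=
  [/\ A \in unitmx, B \in unitmx, is_diag_mx D,
      (forall i j : 'I_m, j = i.+1 :> nat ->
         exists c : {poly int}, D j j = c * D i i)
    & D = A *m M *m B].

Notation "[rmx a ; .. ; b ; z ]" := (row_mx a .. (row_mx b z) ..)
  (at level 0, a, b, z at level 99, only parsing).
Notation "[cmx a ; .. ; b ; z ]" := (col_mx a .. (col_mx b z) ..)
  (at level 0, a, b, z at level 99, only parsing).

Section Matrices.
Local Notation q := ('X : {poly int}).
Local Notation I_ n := (1%:M : 'M[{poly int}]_n).

Definition rowv n (s : seq {poly int}) : 'rV[{poly int}]_n :=
  \row_(j < n) s`_j.

Definition mx_of_rows n (s : seq (seq {poly int})) : 'M[{poly int}]_n :=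
  \matrix_(i < n, j < n) (nth [::] s i)`_j.

Definition circ (s : seq {poly int}) : 'M[{poly int}]_5 :=
  \matrix_(i < 5, j < 5) s`_((j + 5 - i) %% 5).

Definition ones : 'cV[{poly int}]_5 := const_mx 1.

Definition J5 : 'M[{poly int}]_5 := \matrix_(i, j) (j == ordS i)%:R.

Definition P_mx : 'M[{poly int}]_38 :=
  ([cmx [rmx I_ 16 ; - (q *: I_ 16) ; 0] ;
        [rmx 0     ; I_ 16          ; 0] ;
        [rmx 0     ; 0              ; I_ 6]]
   : 'M[{poly int}]_(16 + (16 + 6))).

Definition Q_ (k : nat) : 'rV[{poly int}]_5 := const_mx (q ^+ k).

Definition v11 := circ [:: 1; q^+2; q^+2; q^+2; q^+2].
Definition v12 := circ [:: q; q^+3; q^+3; q^+3; q].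
Definition v13 := circ [:: q^+2; q^+4; q^+4; q^+2; q^+2].
Definition v14 := circ [:: q^+3; q^+5; q^+3; q^+3; q^+3].
Definition v22 := circ [:: 1; q^+2; q^+4; q^+4; q^+2].
Definition v23 := circ [:: q; q^+3; q^+5; q^+3; q].
Definition v24 := v13.
Definition v33 := v22.
Definition v34 := v12.
Definition v44 := v11.

Definition V22_mx : 'M[{poly int}]_22 :=
  ([cmx [rmx I_ 1         ; Q_ 1     ; Q_ 2     ; Q_ 3     ; Q_ 4     ; (q^+5)%:M] ;
        [rmx (Q_ 1)^T     ; v11      ; v12      ; v13      ; v14      ; (Q_ 4)^T ] ;
        [rmx (Q_ 2)^T     ; v12^T    ; v22      ; v23      ; v24      ; (Q_ 3)^T ] ;
        [rmx (Q_ 3)^T     ; v13^T    ; v23^T    ; v33      ; v34      ; (Q_ 2)^T ] ;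
        [rmx (Q_ 4)^T     ; v14^T    ; v24^T    ; v34^T    ; v44      ; (Q_ 1)^T ] ;
        [rmx (q^+5)%:M    ; Q_ 4     ; Q_ 3     ; Q_ 2     ; Q_ 1     ; I_ 1     ]]
   : 'M[{poly int}]_(1 + (5 + (5 + (5 + (5 + 1)))))).

Definition u51 : 'rV[{poly int}]_5 := rowv 5 [:: q^+4; 0; 0; 0; q^+4].
Definition u52 : 'rV[{poly int}]_5 := rowv 5 [:: 0; 0; 0; 0; - q^+3].
Definition u53 : 'rV[{poly int}]_5 := rowv 5 [:: 0; q^+2; 0; 0; 0].
Definition u54 : 'rV[{poly int}]_5 := rowv 5 [:: - q; - q; 0; 0; 0].

Local Notation J := J5.
Local Notation I := (I_ 5).

Definition U1_mx : 'M[{poly int}]_22 :=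
  ([cmx [rmx I_ 1 ; 0 ; 0 ; 0 ; 0 ; 0] ;
        [rmx - q *: ones ; I ; 0 ; 0 ; 0 ; 0] ;
        [rmx q^+2 *: ones ; - q *: (I + J) ; I ; 0 ; 0 ; 0] ;
        [rmx 0 ; q^+2 *: J ; - q *: (I + J) ; I ; 0 ; 0] ;
        [rmx 0 ; - q^+5 *: J^T ; q^+2 *: J + q^+4 *: (J^+3 + J^T) ;
             - q *: (I + J) - q^+3 *: J^+3 ; I ; 0] ;
        [rmx (- q^+5)%:M ; u51 ; u52 ; u53 ; u54 ; I_ 1]]
   : 'M[{poly int}]_(1 + (5 + (5 + (5 + (5 + 1)))))).

Definition u_row : 'rV[{poly int}]_5 :=
  rowv 5 [:: 0; 0; 0; - q^+2 * (1 - q^+2); - q^+2 * (1 - q^+2)].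

Definition U2_mx : 'M[{poly int}]_22 :=
  ([cmx [rmx I_ 1 ; 0 ; 0 ; 0 ; 0 ; 0] ;
        [rmx 0 ; I ; 0 ; 0 ; 0 ; 0] ;
        [rmx 0 ; 0 ; I ; 0 ; 0 ; 0] ;
        [rmx 0 ; 0 ; 0 ; I ; 0 ; 0] ;
        [rmx 0 ; 0 ; 0 ; 0 ; I ; 0] ;
        [rmx 0 ; 0 ; 0 ; u_row ; 0 ; I_ 1]]
   : 'M[{poly int}]_(1 + (5 + (5 + (5 + (5 + 1)))))).

(* The (4, 2) block is q^2 J as in [U1_mx]; its published form q^2 J^2 is a    *)
(* misprint, with which the product below is not diagonal.                     *)
Definition T_mx : 'M[{poly int}]_38 :=
  ([cmx [rmx I_ 1 ; 0 ; 0 ; 0 ; 0] ;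
        [rmx - q *: ones ; I ; 0 ; 0 ; 0] ;
        [rmx q^+2 *: ones ; - q *: (I + J) ; I ; 0 ; 0] ;
        [rmx 0 ; q^+2 *: J ; - q *: (I + J) ; I ; 0] ;
        [rmx 0 ; 0 ; 0 ; 0 ; U2_mx *m U1_mx]]
   : 'M[{poly int}]_(1 + (5 + (5 + (5 + 22))))).

(* Two entries differ from the published ones, which are misprinted (with them *)
(* the determinant is not a unit of Z[q]): (4, 4), published as                *)
(* -q(1-q^2-q^4+q^8), and (5, 5), published as 1+2q^2+2q^4+q^6.                *)
Definition L0_mx : 'M[{poly int}]_6 := mx_of_rows 6
  [:: [:: 1; 0; -1; - q^+2; 0; 0];
      [:: 0; 1; 0; 0; - (1 + q^+2); 0];
      [:: 0; q^+2; 1; - (1 + q^+4 - q^+8); - q^+2 * (1 + q^+2);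
          - q * (1 - q^+4)];
      [:: 0; - q^+3; - q; - q * (- 1 - q^+2 - q^+4 + q^+8); q^+3 * (1 + q^+2);
          1 + q^+2 - q^+6];
      [:: 0; - q^+2 * (1 + q^+2); - q^+2; q^+2 * (1 - q^+6 - q^+8);
          1 + q^+2 + 2 * q^+4 + q^+6; - q^+5 * (1 + q^+2)];
      [:: - q^+2; - 2 * q^+2; 0; 1 + q^+2 - q^+8; 1 + q^+2 + q^+4;
          - q * (1 + q^+4)]].

Definition alpha : {poly int} :=
  q * (2 + 2 * q^+4 + 3 * q^+6 + q^+8 + 2 * q^+10 + 2 * q^+12 + q^+14).

Definition beta : {poly int} :=
  q^+3 * (2 + q^+2 + q^+4 + 2 * q^+6 + q^+8).

Definition R0_mx : 'M[{poly int}]_6 := mx_of_rows 6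
  [:: [:: 1; q^+4; 1 + q^+4 + q^+6 + q^+8; alpha;
          - (1 - 2 * q^+2 - 2 * q^+8 - q^+10); 1 - q^+2 + q^+6];
      [:: 0; 1; q^+2 * (1 + q^+2); beta; 1 + q^+2 + q^+4 + q^+6;
          - q^+2 * (1 + q^+2)];
      [:: 0; 0; 1; q * (1 + q^+6); - (1 - q^+4); 1 + q^+2];
      [:: 0; 0; 0; 0; -1; 1 + q^+2];
      [:: 0; 0; 0; - q * (1 - q^+2); 1 - q^+2; q^+2];
      [:: 0; 0; 0; 1; q; - q * (2 + q^+2)]].

Definition L_mx : 'M[{poly int}]_38 :=
  (block_mx (I_ 32) 0 0 L0_mx : 'M[{poly int}]_(32 + 6)).

Definition R_mx : 'M[{poly int}]_38 :=
  (block_mx (I_ 32) 0 0 R0_mx : 'M[{poly int}]_(32 + 6)).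

Definition W_mx : 'M[{poly int}]_38 :=
  ([cmx [rmx 0 ; 0 ; 0 ; I_ 1 ; 0 ; 0 ; 0 ; 0] ;
        [rmx I_ 1 ; 0 ; 0 ; 0 ; 0 ; 0 ; 0 ; 0] ;
        [rmx 0 ; 0 ; 0 ; 0 ; I_ 5 ; 0 ; 0 ; 0] ;
        [rmx 0 ; I_ 5 ; 0 ; 0 ; 0 ; 0 ; 0 ; 0] ;
        [rmx 0 ; 0 ; 0 ; 0 ; 0 ; I_ 10 ; 0 ; 0] ;
        [rmx 0 ; 0 ; I_ 10 ; 0 ; 0 ; 0 ; 0 ; 0] ;
        [rmx 0 ; 0 ; 0 ; 0 ; 0 ; 0 ; I_ 3 ; 0] ;
        [rmx 0 ; 0 ; 0 ; 0 ; 0 ; 0 ; 0 ; I_ 3]]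
   : 'M[{poly int}]_(1 + (1 + (5 + (5 + (10 + (10 + (3 + 3)))))),
         1 + (5 + (10 + (1 + (5 + (10 + (3 + 3)))))))).

Definition D_mx : 'M[{poly int}]_38 :=
  diag_mx (rowv 38
    (1 :: nseq 6 (1 - q^+2) ++ nseq 15 ((1 - q^+2)^+2)
       ++ nseq 13 ((1 - q^+2)^+3)
       ++ nseq 3 ((1 - q^+2)^+2 * (1 - q^+10)))).

End Matrices.

(* Main.v *)
Require Import Defs.
From HB Require Import structures.
From Stdlib Require Import ZArith.
From mathcomp Require Import all_boot all_order all_algebra.
From mathcomp Require Import finmap.
From mathcomp Require Import all_classical all_reals all_analysis.
From mathcomp Require Import ring lra zify.
From mathcomp.zify Require Import ssrZ.
Import Order.TTheory GRing.Theory Num.Theory.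
Import numFieldNormedType.Exports.
Local Open Scope classical_set_scope.
Local Open Scope ring_scope.

(* Each plane is the zero set of an affine functional, so a region is a        *)
(* nonempty set of points with prescribed signs of the functionals (a cell):   *)
(* cells are convex, and a connected set off the planes cannot change sign.    *)
(* Two cells are separated exactly by the planes at which their signs differ,  *)
(* which turns the q-Varchenko matrices into matrices computed from the        *)
(* strings. The signs that occur are found in affine coordinates where         *)
(* everything is polynomial in [ka = 2 cos (2 pi / 5)], with                   *)
(* [ka * ka = 1 - ka]: each realizable sign vector has an explicit point, and  *)
(* the others contradict                                                       *)
(* [ka * f i = f (i - 1) + f (i + 1) + (2 - ka) * s] (indices mod 5, [s = 1] on *)
(* the base plane, [s = 0] at the apex).                                       *)
(* The identities between polynomial matrices are computed on lists of         *)
(* coefficients.                                                               *)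

(** * Computation with matrices over Z[q] *)

(** Geometry and algebra meet in [string_mx], whose entries are q raised to the size of the
    symmetric difference of two strings.

    Geometry. Regions are cells of prescribed signs, and two of them are separated exactly by the
    hyperplanes at which their signs differ ([regionsP], [separates_cell]). Once the realizable sign
    vectors are known to be those of the given strings, every admissible ordering yields the same
    explicit matrix ([varchenko_string_mx]). Realizability is a finite check: [phi_ray] provides a
    point in each of the 22 cones at the apex, 16 of which meet the base plane, and
    [positive_strings] excludes all other sign vectors by linear arithmetic from [phi_relation].

    Algebra. [P_mx] subtracts q times the row of s from the row of s6. In a column t on the side of
    the pyramid this leaves 0, and in a column t6 it leaves (1 - q^2) q^d, with d the distance from
    s to t; the same operation on columns gives the deletion-restriction block form. A congruence by
    the unipotent [T_mx] then leaves a diagonal matrix except for a 6 x 6 corner, which [L0_mx] and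
    [R0_mx] diagonalize, and [W_mx] sorts the diagonal. Each transition factor is invertible over
    Z[q] as a permutation, as a unipotent matrix, or by an explicit inverse. The identities
    themselves are evaluated ([reflects_eq]). *)

Definition ev (p : seq Z) : {poly int} :=
  foldr (fun c r => (int_of_Z c)%:P + 'X * r) 0 p.

Fixpoint padd (p r : seq Z) : seq Z :=
  match p, r with
  | [::], _ => r
  | _, [::] => p
  | a :: p', b :: r' => Z.add a b :: padd p' r'
  end.

Definition popp (p : seq Z) : seq Z := map Z.opp p.

(** An empty factor gives the empty list, not a list of zeros, so that the many zero entries of the
    matrices cost nothing. *)
Fixpoint pmul (p r : seq Z) : seq Z :=
  match p, r with
  | [::], _ => [::]
  | _, [::] => [::]
  | a :: p', _ => padd (map (Z.mul a) r) (Z0 :: pmul p' r)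
  end.

Fixpoint pexp (p : seq Z) (n : nat) : seq Z :=
  if n is n'.+1 then pmul p (pexp p n') else [:: Z.one].

(** Coefficient lists are never normalized, hence a comparison up to trailing zeros. *)
Fixpoint peq (p r : seq Z) : bool :=
  match p, r with
  | [::], _ => all (pred1 Z.zero) r
  | _, [::] => all (pred1 Z.zero) p
  | a :: p', b :: r' => (a == b) && peq p' r'
  end.

Lemma ev_cons c p : ev (c :: p) = (int_of_Z c)%:P + 'X * ev p.
Proof. by []. Qed.

Lemma ev_add p r : ev (padd p r) = ev p + ev r.
Proof.
elim: p r => [|a p IH] [|b r]; rewrite ?add0r ?addr0 //.
rewrite [padd _ _]/= !ev_cons IH (_ : Z.add a b = a + b)//.
by rewrite rmorphD /= polyCD mulrDr addrACA.
Qed.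

Lemma ev_opp p : ev (popp p) = - ev p.
Proof.
elim: p => [|a p IH]; first by rewrite oppr0.
rewrite [popp _]/= !ev_cons -/(popp p) IH (_ : Z.opp a = - a)//.
by rewrite rmorphN /= polyCN mulrN opprD.
Qed.

Lemma ev_scale a p : ev (map (Z.mul a) p) = (int_of_Z a)%:P * ev p.
Proof.
elim: p => [|b p IH]; first by rewrite mulr0.
rewrite [map _ _]/= !ev_cons IH (_ : Z.mul a b = a * b)//.
by rewrite rmorphM /= polyCM mulrDr mulrCA.
Qed.

Lemma ev_mul p r : ev (pmul p r) = ev p * ev r.
Proof.
elim: p r => [|a p IH] [|b r]; rewrite ?mul0r ?mulr0 //.
rewrite -[pmul _ _]/(padd (map (Z.mul a) (b :: r)) (Z0 :: pmul p (b :: r))).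
by rewrite ev_add ev_scale !(ev_cons _ (pmul _ _)) (ev_cons a) IH polyC0 add0r mulrDl mulrA.
Qed.

Lemma ev_exp p n : ev (pexp p n) = ev p ^+ n.
Proof.
elim: n => [|n IH]; first by rewrite /= mulr0 addr0.
by rewrite exprS -IH -ev_mul.
Qed.

Lemma ev_all0 p : all (pred1 Z.zero) p -> ev p = 0.
Proof.
elim: p => //= a p IH /andP[/eqP-> /IH->].
by rewrite mulr0 addr0.
Qed.

Lemma peqP p r : peq p r -> ev p = ev r.
Proof.
elim: p r => [|a p IH] [|b r].
- by [].
- by move=> /ev_all0->.
- by move=> /ev_all0->.
- by move=> /= /andP[/eqP-> /IH->].
Qed.

Definition lmx := seq (seq (seq Z)).

Definition lnth (l : lmx) (i j : nat) : seq Z := nth [::] (nth [::] l i) j.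

Definition ltab (m n : nat) (f : nat -> nat -> seq Z) : lmx :=
  mkseq (fun i => mkseq (f i) n) m.

Lemma lnth_tab m n f i j : (i < m)%N -> (j < n)%N -> lnth (ltab m n f) i j = f i j.
Proof. by move=> im jn; rewrite /lnth nth_mkseq// nth_mkseq. Qed.

(** A missing entry of [l] reads as zero, so [[::]] represents the zero matrix of any size. *)
Definition reflects (m n : nat) (M : 'M[{poly int}]_(m, n)) (l : lmx) :=
  forall (i : 'I_m) (j : 'I_n), M i j = ev (lnth l i j).
Arguments reflects {m n} M l.

Lemma reflects_tab {m n} (M : 'M[{poly int}]_(m, n)) (f : nat -> nat -> seq Z) :
  (forall (i : 'I_m) (j : 'I_n), M i j = ev (f i j)) -> reflects M (ltab m n f).
Proof. by move=> Mf i j; rewrite Mf lnth_tab. Qed.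

Definition lrow m n1 n2 a b := ltab m (n1 + n2)
  (fun i j => if (j < n1)%N then lnth a i j else lnth b i (j - n1)).

Lemma reflects_row {m n1 n2} {A : 'M[{poly int}]_(m, n1)} {B : 'M[{poly int}]_(m, n2)} {a b} :
  reflects A a -> reflects B b -> reflects (row_mx A B) (lrow m n1 n2 a b).
Proof.
move=> ra rb; apply: reflects_tab => i j; rewrite mxE.
by case: split_ordP => k ->; rewrite ?ra ?rb /= ?addKn // ltnNge leq_addr.
Qed.

Definition lcol m1 m2 n a b := ltab (m1 + m2) n
  (fun i j => if (i < m1)%N then lnth a i j else lnth b (i - m1) j).

Lemma reflects_col {m1 m2 n} {A : 'M[{poly int}]_(m1, n)} {B : 'M[{poly int}]_(m2, n)} {a b} :
  reflects A a -> reflects B b -> reflects (col_mx A B) (lcol m1 m2 n a b).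
Proof.
move=> ra rb; apply: reflects_tab => i j; rewrite mxE.
by case: split_ordP => k ->; rewrite ?ra ?rb /= ?addKn // ltnNge leq_addr.
Qed.

Lemma reflects_block {m1 m2 n1 n2} {A : 'M[{poly int}]_(m1, n1)} {B : 'M[{poly int}]_(m1, n2)}
    {C : 'M[{poly int}]_(m2, n1)} {D : 'M[{poly int}]_(m2, n2)} {a b c d} :
  reflects A a -> reflects B b -> reflects C c -> reflects D d ->
  reflects (block_mx A B C D)
    (lcol m1 m2 (n1 + n2) (lrow m1 n1 n2 a b) (lrow m2 n1 n2 c d)).
Proof.
by move=> ra rb rc rd; apply: reflects_col; apply: reflects_row.
Qed.

Definition ltr m n a := ltab n m (fun i j => lnth a j i).

Lemma reflects_tr {m n} {A : 'M[{poly int}]_(m, n)} {a} :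
  reflects A a -> reflects A^T (ltr m n a).
Proof. by move=> ra; apply: reflects_tab => i j; rewrite mxE ra. Qed.

Definition ladd m n a b := ltab m n (fun i j => padd (lnth a i j) (lnth b i j)).

Lemma reflects_add {m n} {A B : 'M[{poly int}]_(m, n)} {a b} :
  reflects A a -> reflects B b ->
  reflects (A + B) (ladd m n a b).
Proof.
by move=> ra rb; apply: reflects_tab => i j; rewrite mxE ra rb ev_add.
Qed.

Definition lopp m n a := ltab m n (fun i j => popp (lnth a i j)).

Lemma reflects_opp {m n} {A : 'M[{poly int}]_(m, n)} {a} :
  reflects A a -> reflects (- A) (lopp m n a).
Proof. by move=> ra; apply: reflects_tab => i j; rewrite mxE ra ev_opp. Qed.

Definition lscale m n p a := ltab m n (fun i j => pmul p (lnth a i j)).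

Lemma reflects_scale {m n c} {A : 'M[{poly int}]_(m, n)} {p a} :
  c = ev p -> reflects A a ->
  reflects (c *: A) (lscale m n p a).
Proof. by move=> -> ra; apply: reflects_tab => i j; rewrite mxE ra ev_mul. Qed.

(** The padding by [nseq n [::]] serves rows shorter than [n]; the columns of [b] are tabulated once
    rather than extracted again for each entry. *)
Definition lmul m n p (a b : lmx) : lmx :=
  let bt := ltab p n (fun i j => lnth b j i) in
  ltab m p (fun i j =>
    foldr (fun xy s => padd (pmul xy.1 xy.2) s) [::]
          (zip (take n (nth [::] a i ++ nseq n [::])) (nth [::] bt j))).

Lemma reflects_mul {m n p} {A : 'M[{poly int}]_(m, n)} {B : 'M[{poly int}]_(n, p)} {a b} :
  reflects A a -> reflects B b -> reflects (A *m B) (lmul m n p a b).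
Proof.
move=> ra rb; apply: reflects_tab => i j; rewrite mxE.
under eq_bigr => k _ do rewrite ra rb -ev_mul.
set u := take _ _; set v := nth _ _ _.
have su : size u = n by rewrite size_takel// size_cat size_nseq leq_addl.
have sv : size v = n by rewrite /v nth_mkseq// size_mkseq.
have uE (k : nat) : (k < n)%N -> lnth a i k = nth [::] u k.
  move=> kn; rewrite /u nth_take// nth_cat /lnth; case: ltnP => // ak.
  by rewrite nth_nseq if_same nth_default.
have vE (k : nat) : (k < n)%N -> lnth b k j = nth [::] v k.
  by move=> kn; rewrite /v nth_mkseq// nth_mkseq.
under eq_bigr => k _ do rewrite uE// vE//.
rewrite -(big_mkord xpredT (fun k => ev (pmul (nth [::] u k) (nth [::] v k)))).
move: (u) (v) su sv; elim: n {A B ra rb u v uE vE} => [|n IH] [|x u] [|y v] //=.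
  by rewrite big_nil.
by move=> [su] [sv]; rewrite big_nat_recl//= IH// ev_add.
Qed.

Definition lscal n (p : seq Z) := ltab n n (fun i j => if i == j then p else [::]).

Lemma reflects_scalar n c p : c = ev p -> reflects (c%:M : 'M[{poly int}]_n) (lscal n p).
Proof.
move=> ->; apply: reflects_tab => i j; rewrite mxE (_ : (i == j :> nat) = (i == j))//.
by case: eqP => _; rewrite ?mulr1n ?mulr0n.
Qed.

Fixpoint lexp m (a : lmx) (n : nat) : lmx :=
  if n is n'.+1 then lmul m m m a (lexp m a n') else lscal m [:: Z.one].

Lemma reflects_exp {m n} {A : 'M[{poly int}]_m.+1} {a} :
  reflects A a -> reflects (A ^+ n) (lexp m.+1 a n).
Proof.
move=> ra; elim: n => [|n IH].
  by apply: reflects_scalar; rewrite /= mulr0 addr0.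
by rewrite exprS; apply: reflects_mul.
Qed.

Lemma reflects_0 m n : reflects (0 : 'M[{poly int}]_(m, n)) [::].
Proof. by move=> i j; rewrite mxE /lnth !nth_nil. Qed.

Definition lconst m n p : lmx := nseq m (nseq n p).

Lemma reflects_const {m n c p} :
  c = ev p -> reflects (const_mx c : 'M[{poly int}]_(m, n)) (lconst m n p).
Proof. by move=> -> i j; rewrite mxE /lnth nth_nseq ltn_ord nth_nseq ltn_ord. Qed.

Lemma nth_map_ev s k : (map ev s)`_k = ev (nth [::] s k).
Proof.
have [ks|sk] := ltnP k (size s); first by rewrite (nth_map [::]).
by rewrite !nth_default// size_map.
Qed.

Lemma reflects_rowv {n s l} :
  s = map ev l -> reflects (rowv n s) [:: l].
Proof. by move=> -> i j; rewrite mxE ord1 nth_map_ev. Qed.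

Lemma reflects_rows {n s l} :
  s = map (map ev) l -> reflects (mx_of_rows n s) l.
Proof.
move=> -> i j; rewrite mxE /lnth.
have [ks|sk] := ltnP i (size l); first by rewrite (nth_map [::])// nth_map_ev.
by rewrite [nth _ (map _ _) _]nth_default ?size_map// [nth _ l _]nth_default// !nth_nil.
Qed.

Definition lcirc l := ltab 5 5 (fun i j => nth [::] l ((j + 5 - i) %% 5)).

Lemma reflects_circ {s l} : s = map ev l ->
  reflects (circ s) (lcirc l).
Proof. by move=> ->; apply: reflects_tab => i j; rewrite mxE nth_map_ev. Qed.

Lemma reflects_J5 :
  reflects J5 (ltab 5 5 (fun i j => if j == (i.+1 %% 5)%N then [:: Z.one] else [::])).
Proof.
apply: reflects_tab => i j; rewrite mxE (_ : (j == _ :> nat) = (j == ordS i))//.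
by case: eqP => _; rewrite //= mulr0 addr0.
Qed.

Definition ldiag n l :=
  ltab n n (fun i j => if i == j then nth [::] l i else [::]).

Lemma reflects_diag {n s l} : s = map ev l ->
  reflects (diag_mx (rowv n s))(ldiag n l).
Proof.
move=> ->; apply: reflects_tab => i j; rewrite !mxE nth_map_ev.
rewrite (_ : (i == j :> nat) = (i == j))//.
by case: eqP => _; rewrite ?mulr1n ?mulr0n.
Qed.

Definition lmx_eq m n (a b : lmx) :=
  all (fun i => all (fun j => peq (lnth a i j) (lnth b i j)) (iota 0 n)) (iota 0 m).

(** Turns an identity of polynomial matrices into a boolean for [vm_compute]; the lists [a] and [b]
    are found by unification in [reflect_mx]. *)
Lemma reflects_eq {m n} {A B : 'M[{poly int}]_(m, n)} {a b} :
  reflects A a -> reflects B b -> lmx_eq m n a b -> A = B.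
Proof.
move=> ra rb ab; apply/matrixP => i j; rewrite ra rb; apply: peqP.
move/allP: ab => /(_ i); rewrite mem_iota add0n ltn_ord => /(_ isT).
by move=> /allP /(_ j); rewrite mem_iota add0n ltn_ord => /(_ isT).
Qed.

Lemma evD x y p r : x = ev p -> y = ev r -> x + y = ev (padd p r).
Proof. by move=> -> ->; rewrite ev_add. Qed.
Lemma evN x p : x = ev p -> - x = ev (popp p).
Proof. by move=> ->; rewrite ev_opp. Qed.
Lemma evM x y p r : x = ev p -> y = ev r -> x * y = ev (pmul p r).
Proof. by move=> -> ->; rewrite ev_mul. Qed.
Lemma evX x p n : x = ev p -> x ^+ n = ev (pexp p n).
Proof. by move=> ->; rewrite ev_exp. Qed.
Lemma evq : 'X = ev [:: Z.zero; Z.one].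
Proof. by rewrite /= mulr0 addr0 mulr1 polyC0 add0r. Qed.
Lemma ev0 : 0 = ev [::].
Proof. by []. Qed.
Lemma ev1 : 1 = ev [:: Z.one].
Proof. by rewrite /= mulr0 addr0. Qed.
Lemma ev_nat n : n%:R = ev [:: Z.of_nat n].
Proof.
rewrite /= mulr0 addr0 -[Z.of_nat n]/(Z_of_int (Posz n)) Z_of_intK.
by rewrite -[in RHS](natz n) polyC_natr.
Qed.

Lemma map_ev_nil : [::] = map ev [::].
Proof. by []. Qed.
Lemma map_ev_cons x s p l : x = ev p -> s = map ev l -> x :: s = map ev (p :: l).
Proof. by move=> -> ->. Qed.
Lemma map_ev_cat s t l k : s = map ev l -> t = map ev k -> s ++ t = map ev (l ++ k).
Proof. by move=> -> ->; rewrite map_cat. Qed.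
Lemma map_ev_nseq n x p : x = ev p -> nseq n x = map ev (nseq n p).
Proof. by move=> ->; rewrite map_nseq. Qed.
Lemma mapmap_ev_nil : [::] = map (map ev) [::].
Proof. by []. Qed.
Lemma mapmap_ev_cons x s p l :
  x = map ev p -> s = map (map ev) l -> x :: s = map (map ev) (p :: l).
Proof. by move=> -> ->. Qed.

Ltac reflect_poly :=
  lazymatch goal with
  | |- 'X = _ => exact: evq
  | |- 0 = _ => exact: ev0
  | |- 1 = _ => exact: ev1
  | |- _ + _ = _ => apply: evD; reflect_poly
  | |- - _ = _ => apply: evN; reflect_poly
  | |- _ * _ = _ => apply: evM; reflect_poly
  | |- _ ^+ _ = _ => apply: evX; reflect_poly
  | |- _%:R = _ => exact: ev_nat
  | |- ?x = _ => let x' := eval red in x in change x with x'; reflect_poly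
  end.

Ltac reflect_seq :=
  lazymatch goal with
  | |- [::] = _ => exact: map_ev_nil
  | |- (_ :: _) = _ => apply: map_ev_cons; [reflect_poly | reflect_seq]
  | |- nseq _ _ = _ => apply: map_ev_nseq; reflect_poly
  | |- _ ++ _ = _ => apply: map_ev_cat; reflect_seq
  end.

Ltac reflect_rows :=
  lazymatch goal with
  | |- [::] = _ => exact: mapmap_ev_nil
  | |- (_ :: _) = _ => apply: mapmap_ev_cons; [reflect_seq | reflect_rows]
  end.

(* The dimensions of a block matrix are only convertible to the expected ones, *)
(* hence [refine] with all of them explicit.                                   *)
Ltac reflect_mx :=
  lazymatch goal with
  | H : @reflects _ _ ?M _ |- @reflects _ _ ?M _ => exact: H
  | |- @reflects _ _ (@row_mx _ ?m ?n1 ?n2 ?A ?B) _ =>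
      refine (@reflects_row m n1 n2 A B _ _ _ _); reflect_mx
  | |- @reflects _ _ (@col_mx _ ?m1 ?m2 ?n ?A ?B) _ =>
      refine (@reflects_col m1 m2 n A B _ _ _ _); reflect_mx
  | |- @reflects _ _ (@block_mx _ ?m1 ?m2 ?n1 ?n2 ?A ?B ?C ?D) _ =>
      refine (@reflects_block m1 m2 n1 n2 A B C D _ _ _ _ _ _ _ _); reflect_mx
  | |- @reflects _ _ (@trmx _ ?m ?n ?A) _ =>
      refine (@reflects_tr m n A _ _); reflect_mx
  | |- @reflects _ _ (@mulmx _ ?m ?n ?p ?A ?B) _ =>
      refine (@reflects_mul m n p A B _ _ _ _); reflect_mx
  | |- @reflects ?m ?n (?A + ?B) _ =>
      refine (@reflects_add m n A B _ _ _ _); reflect_mx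
  | |- @reflects ?m ?n (- ?A) _ => refine (@reflects_opp m n A _ _); reflect_mx
  | |- @reflects ?m ?n (?c *: ?A) _ =>
      refine (@reflects_scale m n c A _ _ _ _); [reflect_poly | reflect_mx]
  | |- @reflects (S ?m) _ (?A ^+ ?k) _ =>
      refine (@reflects_exp m k A _ _); reflect_mx
  | |- @reflects ?m ?n (scalar_mx _) _ =>
      refine (@reflects_scalar m _ _ _); reflect_poly
  | |- @reflects _ _ (const_mx _) _ => refine (reflects_const _); reflect_poly
  | |- @reflects ?m ?n (@GRing.one _) _ =>
      refine (@reflects_scalar m _ _ _); reflect_poly
  | |- @reflects ?m ?n (@GRing.zero _) _ => exact: (reflects_0 m n)
  | |- @reflects _ _ J5 _ => exact: reflects_J5
  | |- @reflects _ _ (rowv _ _) _ => refine (reflects_rowv _); reflect_seq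
  | |- @reflects _ _ (diag_mx (rowv _ _)) _ => refine (reflects_diag _); reflect_seq
  | |- @reflects _ _ (circ _) _ => refine (reflects_circ _); reflect_seq
  | |- @reflects _ _ (mx_of_rows _ _) _ => refine (reflects_rows _); reflect_rows
  | |- @reflects _ _ ?M _ => let M' := eval red in M in change M with M'; reflect_mx
  end.

(** * Symmetric-difference matrices and their Smith normal form *)

Definition symdiff (idx s t : seq nat) := count (fun i => (i \in s) != (i \in t)) idx.

Definition string_mx (idx : seq nat) (ss : seq (seq nat)) m : 'M[{poly int}]_m :=
  \matrix_(i, j) 'X ^+ symdiff idx (nth [::] ss i) (nth [::] ss j).

Lemma reflects_string_mx idx ss m : reflects (string_mx idx ss m)
  (ltab m m (fun i j => pexp [:: Z.zero; Z.one] (symdiff idx (nth [::] ss i) (nth [::] ss j)))).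
Proof. by apply: reflects_tab => i j; rewrite mxE ev_exp -evq. Qed.

Ltac mx_compute :=
  refine (reflects_eq _ _ _);
  [reflect_mx | reflect_mx | vm_compute; reflexivity].

Lemma string_mx22 : string_mx (iota 1 5) strings22 22 = V22_mx.
Proof.
have H := reflects_string_mx (iota 1 5) strings22 22.
mx_compute.
Qed.

Lemma string_mx_deletion_restriction :
  P_mx *m string_mx (iota 1 6) strings38 38 *m P_mx^T =
  (block_mx ((1 - 'X ^+ 2) *: string_mx (iota 1 5) strings16 16) 0
            0 (string_mx (iota 1 5) strings22 22) : 'M[{poly int}]_(16 + 22)).
Proof.
have H38 := reflects_string_mx (iota 1 6) strings38 38.
have H22 := reflects_string_mx (iota 1 5) strings22 22.
have H16 := reflects_string_mx (iota 1 5) strings16 16.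
mx_compute.
Qed.

Lemma string_mx_smith :
  D_mx = W_mx *m L_mx *m T_mx *m P_mx *m string_mx (iota 1 6) strings38 38
     *m ((T_mx *m P_mx)^T *m R_mx *m W_mx^T).
Proof.
have H38 := reflects_string_mx (iota 1 6) strings38 38.
mx_compute.
Qed.

Lemma W_unit : W_mx \in unitmx.
Proof.
have : W_mx *m W_mx^T = (1%:M : 'M[{poly int}]_38) by mx_compute.
by move=> /mulmx1_unit[].
Qed.

(** The inverse is the finite geometric series in [1 - M]. *)
Lemma unipotent_unitmx (M : 'M[{poly int}]_38) k : (1 - M) ^+ k = 0 -> M \in unitmx.
Proof.
move=> nM.
have H : M *m (\sum_(i < k) (1 - M) ^+ i) = 1%:M.
  have /esym := subrX1 (1 - M) k.
  by rewrite nM sub0r addrAC subrr add0r mulNr => /oppr_inj.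
by have [] := mulmx1_unit H.
Qed.

Lemma P_unit : P_mx \in unitmx.
Proof.
have H : (1 - (P_mx : 'M[{poly int}]_(37.+1))) ^+ 2 = 0 by mx_compute.
exact: unipotent_unitmx H.
Qed.

Lemma T_unit : T_mx \in unitmx.
Proof.
(* [T_mx] is a direct sum of two unipotent lower block triangular matrices with four and six block
   rows, so the exponent 7 is ample. *)
have H : (1 - (T_mx : 'M[{poly int}]_(37.+1))) ^+ 7 = 0 by mx_compute.
exact: unipotent_unitmx H.
Qed.

Section TransitionUnits.
Local Notation q := ('X : {poly int}).

Definition L0_inv : 'M[{poly int}]_6 := mx_of_rows 6
  [:: [:: 1 + q^+2 + q^+4; q^+4 + q^+6 + q^+8;
          1 + 2 * q^+2 + 2 * q^+4 + 2 * q^+6 + 3 * q^+8 + 2 * q^+10 + q^+12;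
          2 * q + q^+3 + 2 * q^+7 + 2 * q^+9 + q^+11;
          - 1 + 2 * q^+4 + q^+6; 1 + q^+2];
      [:: 0; 1 + q^+2 + q^+4; q^+2 + 2 * q^+4 + 2 * q^+6 + q^+8;
          q^+3 + 2 * q^+5 + q^+7; 1 + q^+2; 0];
      [:: q^+2; q^+6; 1 + 2 * q^+2 + q^+4 + q^+6 + q^+8 + q^+10;
          2 * q + q^+7 + q^+9; - 1 + q^+2 + q^+4; 1];
      [:: q^+2; q^+2 + q^+6; q^+2 + q^+4 + 2 * q^+6 + q^+8 + q^+10;
          q + q^+5 + q^+7 + q^+9; - 1 + q^+2 + q^+4; 1];
      [:: 0; q^+2; q^+2 + q^+4 + q^+6; q^+3 + q^+5; 1; 0];
      [:: - q^+5; - q^+5 - q^+9; q - q^+5 - q^+7 - 2 * q^+9 - q^+11 - q^+13;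
          1 - q^+4 - q^+8 - q^+10 - q^+12; q^+3 - q^+5 - q^+7; - q^+3]].

Definition R0_inv : 'M[{poly int}]_6 := mx_of_rows 6
  [:: [:: 1; - q^+4; - 1 - q^+4; - q^+4 - q^+6; - q^+2; - q - q^+3];
      [:: 0; 1; - q^+2 - q^+4; q^+2; - 1 - q^+2 - 2 * q^+4 - q^+6;
          - q - q^+3 - q^+5];
      [:: 0; 0; 1; - 1 - 2 * q^+2 - q^+8 + q^+10 + q^+12;
          - q^+2 - q^+4 - q^+6 - q^+8; - q - q^+3 - q^+7 + q^+11];
      [:: 0; 0; 0; 2 * q - q^+5; q; 1 + q^+2 - q^+4];
      [:: 0; 0; 0; q^+2 - q^+4 - q^+6; 1 + q^+2; q - q^+5];
      [:: 0; 0; 0; 1 - q^+4; 1; q - q^+3]].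

Lemma L0_unit : L0_mx \in unitmx.
Proof.
have H : L0_mx *m L0_inv = 1%:M by mx_compute.
by have [] := mulmx1_unit H.
Qed.

Lemma R0_unit : R0_mx \in unitmx.
Proof.
have H : R0_mx *m R0_inv = 1%:M by mx_compute.
by have [] := mulmx1_unit H.
Qed.

Lemma unitmx_block_id m n (M : 'M[{poly int}]_n) : M \in unitmx ->
  (block_mx (1%:M : 'M[{poly int}]_m) 0 0 M : 'M[{poly int}]_(m + n)) \in unitmx.
Proof. by rewrite !unitmxE det_ublock det1 mul1r. Qed.

Lemma L_unit : L_mx \in unitmx.
Proof. exact: (@unitmx_block_id 32 6 L0_mx L0_unit). Qed.

Lemma R_unit : R_mx \in unitmx.
Proof. exact: (@unitmx_block_id 32 6 R0_mx R0_unit). Qed.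

Lemma D_divisibility (i j : 'I_38) : j = i.+1 :> nat ->
  exists c : {poly int}, D_mx j j = c * D_mx i i.
Proof.
(* The 37 successive quotients of the diagonal; the last one different from 1 is (1 - q^10) / (1 -
   q^2). *)
pose cs : seq {poly int} := (1 - q^+2) :: nseq 5 1 ++ (1 - q^+2) :: nseq 14 1 ++
  (1 - q^+2) :: nseq 12 1 ++ (1 + q^+2 + q^+4 + q^+6 + q^+8) :: nseq 2 1.
have [l Dl lE] : exists2 l, reflects D_mx l &
    exists2 c, cs = map ev c &
    all (fun k => peq (lnth l k.+1 k.+1) (pmul (nth [::] c k) (lnth l k k))) (iota 0 37).
  rewrite /cs; eexists; first reflect_mx.
  by eexists; [reflect_seq | vm_compute].
case: lE => c _ /allP lc ij; exists (ev (nth [::] c i)).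
rewrite !Dl -ev_mul ij; apply: peqP; apply: lc.
by rewrite mem_iota /= add0n -ltnS -ij ltn_ord.
Qed.

End TransitionUnits.

Lemma string_mx_smith_normal_form :
  is_smith_normal_form (string_mx (iota 1 6) strings38 38) D_mx
    (W_mx *m L_mx *m T_mx *m P_mx) ((T_mx *m P_mx)^T *m R_mx *m W_mx^T).
Proof.
split.
- by rewrite !unitmx_mul W_unit L_unit T_unit P_unit.
- by rewrite !unitmx_mul !unitmx_tr !unitmx_mul W_unit R_unit T_unit P_unit.
- exact: diag_mx_is_diag.
- exact: D_divisibility.
- exact: string_mx_smith.
Qed.

Set Implicit Arguments.
Unset Strict Implicit.

(** * Regions of an arrangement given by affine functionals *)

Section Dot.
Variables (R : realType) (d : nat).
Implicit Types u x y : 'rV[R]_d.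

Lemma dotE u x : dot u x = \sum_i u 0 i * x 0 i.
Proof. by rewrite /dot mxE; apply: eq_bigr => i _; rewrite mxE. Qed.

Lemma dotDr u x y : dot u (x + y) = dot u x + dot u y.
Proof. by rewrite /dot linearD mulmxDr mxE. Qed.

Lemma dotZr u t x : dot u (t *: x) = t * dot u x.
Proof. by rewrite /dot linearZ -scalemxAr mxE. Qed.

Lemma dotNl u x : dot (- u) x = - dot u x.
Proof. by rewrite /dot mulNmx mxE. Qed.

Lemma dotC x y : dot x y = dot y x.
Proof. by rewrite !dotE; apply: eq_bigr => i _; rewrite mulrC. Qed.

Lemma dot_sumr u n (t : 'I_n -> R) (p : 'I_n -> 'rV[R]_d) :
  dot u (\sum_i t i *: p i) = \sum_i t i * dot u (p i).
Proof.
elim/big_ind2 : _ => [|x r y s <- <-|i _]; last by rewrite dotZr.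
  by rewrite -[X in dot _ X](scale0r 0) dotZr mul0r.
by rewrite dotDr.
Qed.

Lemma dot_continuous u : continuous (dot u : 'rV[R]_d -> R).
Proof.
rewrite (_ : dot u = fun x => \sum_i u 0 i * x 0 i); last first.
  by apply/funext => x; rewrite dotE.
apply: continuous_big => [|i _ x]; first exact: add_continuous.
apply: continuousM; [exact: cst_continuous | exact: coord_continuous].
Qed.

Lemma segment_connected_mx x y : connected [set (1 - t) *: x + t *: y | t in `[0, 1 : R]%classic].
Proof.
apply: connected_continuous_connected; first exact: segment_connected.
apply: continuous_subspaceT => t.
apply: cvgD; apply: cvgZr_tmp.
  by apply: cvgB; [exact: cvg_cst | exact: cvg_id].
exact: cvg_id.
Qed.

End Dot.

Lemma card_fset_set_image (T : choiceType) (H : nat -> T) (s : seq nat) :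
  uniq s -> {in s &, injective H} ->
  #|` fset_set [set H i | i in [set` s]]| = size s.
Proof.
move=> us Hinj.
have sE : [set` s] = [set` [fset i in s]%fset].
  by apply/seteqP; split => i /=; rewrite in_fset.
rewrite fset_set_image ?sE// set_fsetK card_in_imfset /=.
  by rewrite card_fseq undup_id.
by move=> i j; rewrite !in_fset; apply: Hinj.
Qed.

Lemma convex_gt (R : realFieldType) (b u v t : R) :
  0 <= t <= 1 -> b < u -> b < v -> b < (1 - t) * u + t * v.
Proof.
move=> /andP[t0 t1] bu bv; have [->|tn0] := eqVneq t 0; first lra.
have : 0 < t * (v - b) by rewrite mulr_gt0 ?subr_gt0// lt_neqAle eq_sym tn0.
have : 0 <= (1 - t) * (u - b) by rewrite mulr_ge0 ?subr_ge0// ltW.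
lra.
Qed.

Lemma convex_lt (R : realFieldType) (b u v t : R) :
  0 <= t <= 1 -> u < b -> v < b -> (1 - t) * u + t * v < b.
Proof.
move=> t01 ub vb; have := @convex_gt R (- b) (- u) (- v) t t01; rewrite !ltrN2.
by move=> /(_ ub vb); lra.
Qed.

Section Cells.
Variables (R : realType) (d : nat) (E : set 'rV[R]_d).
Variables (N : nat -> 'rV[R]_d) (b : nat -> R) (idx : seq nat).
Variables (H : nat -> set 'rV[R]_d) (ss : seq (seq nat)).

Let A := [set H i | i in [set` idx]].

Definition cell (s : seq nat) : set 'rV[R]_d :=
  [set x | E x /\
           {in idx, forall i, if i \in s then b i < dot (N i) x else dot (N i) x < b i}].

Hypothesis E_line : forall x y t, E x -> E y -> E ((1 - t) *: x + t *: y).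
Hypothesis HE : {in idx, forall i, H i = E `&` [set x | dot (N i) x = b i]}.
Hypothesis idx_uniq : uniq idx.
Hypothesis ss_idx : all (fun s => subseq s idx) ss.
Hypothesis ss_inj : forall k l, (k < size ss)%N -> (l < size ss)%N ->
  {in idx, forall i, (i \in nth [::] ss k) = (i \in nth [::] ss l)} -> k = l.
Hypothesis ss0 : [::] \in ss.
Hypothesis ss1 : {in idx, forall i, [:: i] \in ss}.
Hypothesis cell_neq0 : forall s, s \in ss -> cell s !=set0.
Hypothesis cell_cover : forall x, E x -> {in idx, forall i, dot (N i) x != b i} ->
  exists2 s, s \in ss & cell s x.

Lemma dot_line (u x y : 'rV[R]_d) t :
  dot u ((1 - t) *: x + t *: y) = (1 - t) * dot u x + t * dot u y.
Proof. by rewrite dotDr !dotZr. Qed.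

Lemma cell_convex s x y t : cell s x -> cell s y -> 0 <= t <= 1 ->
  cell s ((1 - t) *: x + t *: y).
Proof.
move=> [Ex sx] [Ey sy] t01; split; first exact: E_line.
move=> i ii; move: (sx i ii) (sy i ii); rewrite dot_line.
by case: ifP => _ xi yi; [apply: convex_gt | apply: convex_lt].
Qed.

Lemma cell_complement s x : cell s x -> arr_complement E A x.
Proof.
move=> [Ex sx]; split => // -[_ [i ii <-]]; rewrite HE// => -[_ /= xi].
by have := sx i ii; rewrite xi ltxx if_same.
Qed.

(** The values of the i-th functional on [B] form an interval that misses [b i]. *)
Lemma connected_same_sign (B : set 'rV[R]_d) x y i : i \in idx -> connected B ->
  B `<=` arr_complement E A -> B x -> B y ->
  (b i < dot (N i) x) = (b i < dot (N i) y).
Proof.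
move=> ii Bc BA.
have Bint : is_interval (dot (N i) @` B).
  apply/connected_intervalP/connected_continuous_connected => //.
  exact/continuous_subspaceT/dot_continuous.
have Bne z : B z -> dot (N i) z != b i.
  move=> Bz; apply/eqP => zi; have [Ez] := BA _ Bz; apply.
  by exists (H i); [exists i | rewrite HE].
have le u v : B u -> B v -> b i < dot (N i) u -> b i < dot (N i) v.
  move=> Bu Bv ui; rewrite ltNge; apply/negP => vi.
  have [z Bz zi] : (dot (N i) @` B) (b i).
    apply: (Bint (dot (N i) v) (dot (N i) u)); [by exists v | by exists u |].
    by rewrite vi ltW.
  by move/eqP: (Bne _ Bz).
by move=> Bx By; apply/idP/idP; apply: le.
Qed.

(** A cell is convex, so segments inside it connect its points; conversely no connected set off the
    hyperplanes changes sign. *)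
Lemma connected_component_cell s x : cell s x ->
  connected_component (arr_complement E A) x = cell s.
Proof.
move=> sx; apply/seteqP; split => y; last first.
  move=> sy; exists [set (1 - t) *: x + t *: y | t in `[0, 1 : R]%classic].
    split; last exact: segment_connected_mx.
      by exists 0; rewrite /= ?in_itv/= ?lexx ?ler01// subr0 scale1r scale0r addr0.
    move=> _ [t t01 <-]; apply: (@cell_complement s); exact: cell_convex.
  by exists 1; rewrite /= ?in_itv/= ?lexx ?ler01// subrr scale1r scale0r add0r.
move=> [B [Bx BA Bc] By]; have [Ey Ny] := BA _ By.
split => // i ii; have := connected_same_sign ii Bc BA Bx By.
have yi : dot (N i) y != b i.
  apply/eqP => yi; apply: Ny; by exists (H i); [exists i | rewrite HE].
have := sx.2 i ii; case: ifP => _.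
  by move=> -> <-.
by rewrite [_ < b i in X in _ -> _ -> X]lt_neqAle yi /= leNgt => /ltW; rewrite leNgt => /negbTE-> <-.
Qed.

Lemma regionsP C : regions E A C <-> exists2 s, s \in ss & C = cell s.
Proof.
split=> [[x [Ex Nx] ->]|[s sss ->]].
  have [|s sss sx] := cell_cover Ex.
    move=> i ii; apply/eqP => xi; apply: Nx.
    by exists (H i); [exists i | rewrite HE].
  by exists s => //; apply: connected_component_cell.
have [x sx] := cell_neq0 sss.
by exists x; rewrite ?(connected_component_cell sx)//; apply: cell_complement sx.
Qed.

(** [separates] allows any equation of [H i] within [E], so a separating functional [u] is compared
    with [N i] through a common point of [H i]. *)
Lemma separates_cell C C' s s' i : C `<=` cell s -> C' `<=` cell s' ->
  C !=set0 -> C' !=set0 -> i \in idx ->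
  separates E (H i) C C' <-> (i \in s) != (i \in s').
Proof.
move=> Cs Cs' [x Cx] [y Cy] ii; split=> [[u [c [Hu sc cs']]]|].
  have [sx sy] := (Cs _ Cx, Cs' _ Cy).
  have /= xc := sc _ Cx; have /= cy := cs' _ Cy.
  (* The parameter at which the segment from [x] to [y] crosses [dot u = c]. The crossing point lies
     in [H i], whereas [N i] would keep a strict sign along the segment if [s] and [s'] agreed at
     [i]. *)
  pose t := (c - dot u x) / (dot u y - dot u x).
  have xy : 0 < dot u y - dot u x by lra.
  have t01 : 0 <= t <= 1.
    apply/andP; split; first by rewrite divr_ge0// ?ltW//; lra.
    by rewrite ler_pdivrMr// mul1r; lra.
  apply/negP => /eqP ss'.
  have : (H i) ((1 - t) *: x + t *: y).
    rewrite Hu; split; first exact: E_line sx.1 sy.1.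
    have tE : t * (dot u y - dot u x) = c - dot u x by rewrite /t divfK// gt_eqF.
    by rewrite /= dot_line; lra.
  rewrite HE// => -[_]; rewrite /= dot_line => zi.
  have := sx.2 i ii; have := sy.2 i ii; rewrite ss'.
  by case: ifP => _ yi xi; [have := convex_gt t01 xi yi | have := convex_lt t01 xi yi];
    rewrite zi ltxx.
have sub s0 : i \in s0 -> cell s0 `<=` [set x | b i < dot (N i) x].
  by move=> is0 z [_ /(_ i ii)]; rewrite is0.
have sub' s0 : i \notin s0 -> cell s0 `<=` [set x | dot (N i) x < b i].
  by move=> is0 z [_ /(_ i ii)]; rewrite (negbTE is0).
case is1 : (i \in s); case is2 : (i \in s') => // _.
  exists (- N i), (- b i); split.
  - rewrite HE//; congr (_ `&` _); apply/seteqP; split => z /=; rewrite dotNl.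
      by move=> ->.
    exact: oppr_inj.
  - by move=> z /Cs /sub /=; rewrite dotNl ltrN2; apply.
  - by move=> z /Cs' /sub' /=; rewrite dotNl ltrN2; apply; rewrite is2.
exists (N i), (b i); split; first exact: HE.
- by apply: subset_trans Cs _; apply: sub'; rewrite is1.
- by apply: subset_trans Cs' _; apply: sub.
Qed.

(** The cells of [[::]] and [[:: i]] have different signs at [i] alone, so [H i] separates them and
    no [H j] with another index [j] does. *)
Lemma hyperplane_inj : {in idx &, injective H}.
Proof.
move=> i j ii jj Hij; apply/eqP/negPn/negP => ij.
have sub s : cell s `<=` cell s by [].
have := separates_cell (sub [::]) (sub [:: i]) (cell_neq0 ss0) (cell_neq0 (ss1 ii)).
move=> sepP; have : separates E (H i) (cell [::]) (cell [:: i]).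
  by apply/sepP => //; rewrite mem_seq1 eqxx.
rewrite Hij => /sepP; rewrite mem_seq1 => /(_ jj).
by rewrite in_nil [j == i]eq_sym (negbTE ij).
Qed.

Lemma sep_cell C C' s s' : C `<=` cell s -> C' `<=` cell s' ->
  C !=set0 -> C' !=set0 ->
  sep E A C C' = [set H i | i in [set` [seq i <- idx | (i \in s) != (i \in s')]]].
Proof.
move=> Cs Cs' C0 C0'; apply/seteqP; split => [_ [[i ii <-]]|_ [i + <-]].
  move=> /(separates_cell Cs Cs' C0 C0' ii) ?.
  by exists i => //=; rewrite mem_filter ii andbT.
rewrite /= mem_filter => /andP[si ii]; split; first by exists i.
exact/(separates_cell Cs Cs' C0 C0').
Qed.

(** [B] is only required to lie inside the base cell: for the arrangement without the base plane it
    is the interior of the pyramid, smaller than the region around it. *)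
Lemma sep_base_cell B s : B `<=` cell [::] -> B !=set0 -> s \in ss ->
  sep E A B (cell s) = [set H i | i in [set` s]].
Proof.
move=> Bs B0 sss; rewrite (@sep_cell _ _ [::] s)//; last exact: cell_neq0.
congr image; apply/seteqP; split => i /=.
  by rewrite mem_filter in_nil; case: (i \in s).
move=> si; rewrite mem_filter si in_nil /=.
by move/allP: ss_idx => /(_ s sss) /mem_subseq; apply.
Qed.

Lemma regions_base : regions E A (cell [::]).
Proof. by apply/regionsP; exists [::]. Qed.

Let cells m (k : 'I_m) := cell (nth [::] ss k).

Lemma image_idx_inj s s' : s \in ss -> s' \in ss ->
  [set H i | i in [set` s]] = [set H i | i in [set` s']] ->
  {in idx, forall i, (i \in s) = (i \in s')}.
Proof.
move=> + + ss' i ii.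
have sub t : t \in ss -> {subset t <= idx}.
  by move=> tss; move/allP: ss_idx => /(_ t tss) /mem_subseq.
have imP t : t \in ss -> (i \in t) <-> [set H i | i in [set` t]] (H i).
  move=> tss; split => [it|[j jt /hyperplane_inj]]; first by exists i.
  by move=> <- //; apply: sub jt.
by move=> sss sss'; apply/idP/idP => /imP si; apply/imP => //; [rewrite -ss'|rewrite ss']; apply: si.
Qed.

Lemma region_ordering_cells B m : B `<=` cell [::] -> B !=set0 -> m = size ss ->
  region_ordering E A H B ss (@cells m).
Proof.
move=> Bs B0 mss; have kss (k : 'I_m) : nth [::] ss k \in ss by rewrite mem_nth// -mss.
split; last by move=> k; rewrite sep_base_cell.
split.
- by move=> k _; apply/regionsP; exists (nth [::] ss k).
- move=> k l _ _ kl; apply/val_inj/ss_inj; rewrite -?mss ?ltn_ord// => i ii.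
  have [x kx] := cell_neq0 (kss k).
  have lx : cell (nth [::] ss l) x by rewrite -[cell _]/(cells l) -kl.
  move: (kx.2 i ii) (lx.2 i ii).
  by do 2 case: ifP => // _; move=> /lt_trans /[apply]; rewrite ltxx.
- move=> C /regionsP[s sss ->].
  have sm : (index s ss < m)%N by rewrite mss index_mem.
  by exists (Ordinal sm); rewrite // /cells /= nth_index.
Qed.

(** An admissible ordering is unique: by injectivity of [H] the separating hyperplanes determine the
    string, and the string determines the cell. *)
Lemma varchenko_string_mx B m (r : 'I_m -> set 'rV[R]_d) :
  B `<=` cell [::] -> B !=set0 -> m = size ss -> region_ordering E A H B ss r -> varchenko E A r = string_mx idx ss m.
Proof.
move=> Bs B0 mss [[rA _ _] rsep].
have kss (k : 'I_m) : nth [::] ss k \in ss by rewrite mem_nth// -mss.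
have rE k : r k = cell (nth [::] ss k).
  have /regionsP[s sss rs] := rA k I.
  have := rsep k; rewrite rs sep_base_cell// => /(image_idx_inj sss (kss k)) sk.
  congr cell; rewrite -(nth_index [::] sss); congr nth.
  by apply: ss_inj; rewrite ?index_mem -?mss ?ltn_ord ?nth_index.
apply/matrixP => i j; rewrite !mxE !rE (@sep_cell _ _ (nth [::] ss i) (nth [::] ss j))//; last 2 first.
- exact: cell_neq0.
- exact: cell_neq0.
rewrite card_fset_set_image.
- by rewrite size_filter.
- exact: filter_uniq.
- by move=> k l; rewrite !mem_filter => /andP[_ ?] /andP[_ ?]; apply: hyperplane_inj.
Qed.

Lemma cell_arrangement B m : B `<=` cell [::] -> B !=set0 -> m = size ss ->
  [/\ {in idx &, injective H}, regions E A (cell [::]),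
      exists r : 'I_m -> set 'rV[R]_d, region_ordering E A H B ss r &
      forall r : 'I_m -> set 'rV[R]_d, region_ordering E A H B ss r ->
        varchenko E A r = string_mx idx ss m].
Proof.
move=> Bs B0 mss; split; first exact: hyperplane_inj.
- exact: regions_base.
- by exists (@cells m); apply: region_ordering_cells.
- by move=> r; apply: varchenko_string_mx.
Qed.

End Cells.

(** Reduces the distinctness of the sign vectors to a [uniq] test settled by evaluation. *)
Lemma strings_inj (idx : seq nat) (ss : seq (seq nat)) :
  uniq [seq [seq i <- idx | i \in s] | s <- ss] ->
  forall k l, (k < size ss)%N -> (l < size ss)%N ->
  {in idx, forall i, (i \in nth [::] ss k) = (i \in nth [::] ss l)} -> k = l.
Proof.
move=> us k l ks ls kl; apply/eqP.
rewrite -(nth_uniq [::] _ _ us) ?size_map// !(nth_map [::])//.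
by apply/eqP/eq_in_filter.
Qed.

(** * The pyramid in affine coordinates *)

Section PentagonCoordinates.
Variable R : realType.
Implicit Type ka : R.

(** The cosines of the multiples of 2 pi / 5, and in [penty] the sines divided by sin (2 pi / 5), as
    polynomials in [ka]. *)
Definition pentx ka (k : nat) : R :=
  [:: 1; ka / 2; - (ka + 1) / 2; - (ka + 1) / 2; ka / 2]`_k.
Definition penty ka (k : nat) : R := [:: 0; 1; ka; - ka; -1]`_k.

Lemma cos_sin_2pi5 (C := cos (2 * pi / 5 : R)) (S := sin (2 * pi / 5 : R)) :
  [/\ 0 < C, 0 < S, C ^+ 2 + S ^+ 2 = 1 & 4 * C ^+ 2 + 2 * C = 1].
Proof.
have p0 : 0 < pi :> R by exact: pi_gt0.
have C0 : 0 < C by apply: cos_gt0_pihalf; lra.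
have S0 : 0 < S by apply: sin_gt0_pihalf; lra.
have CS : C ^+ 2 + S ^+ 2 = 1 by exact: cos2Dsin2.
split => //.
(* For t = 2 pi / 5, 3 t = 2 pi - 2 t. Written in [C], cos 3t = cos 2t factors as (C - 1) (4 C^2 + 2
   C - 1) = 0, and [C] is not 1. *)
have c3 : cos (2 * pi / 5 + (2 * pi / 5 + 2 * pi / 5) : R)
        = cos (2 * pi / 5 + 2 * pi / 5).
  rewrite -[LHS]cosN -[LHS]cosD2pi; congr cos; lra.
move: c3; rewrite !(cosD, sinD) -/C -/S => c3.
have C1 : C < 1 by nra.
have : (C - 1) * (4 * C ^+ 2 + 2 * C - 1) = 0 by nra.
by move/eqP; rewrite mulf_eq0 => /orP[]/eqP ?; lra.
Qed.

Lemma cos_sin_pentagon (k : 'I_5) (ka := 2 * cos (2 * pi / 5 : R)) :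
  cos (2 * pi * k%:R / 5) = pentx ka k /\
  sin (2 * pi * k%:R / 5) = sin (2 * pi / 5) * penty ka k.
Proof.
have [C0 S0 CS CC] := cos_sin_2pi5.
have E2 : 2 * pi * 2%:R / 5 = 2 * pi / 5 + 2 * pi / 5 :> R by lra.
have c3 : cos (2 * pi * 3%:R / 5 : R) = cos (2 * pi * 2%:R / 5).
  rewrite -[LHS]cosN -[LHS]cosD2pi; congr cos; lra.
have s3 : sin (2 * pi * 3%:R / 5 : R) = - sin (2 * pi * 2%:R / 5).
  rewrite -sinN -[RHS]sinD2pi; congr sin; lra.
have c4 : cos (2 * pi * 4%:R / 5 : R) = cos (2 * pi / 5).
  rewrite -[LHS]cosN -[LHS]cosD2pi; congr cos; lra.
have s4 : sin (2 * pi * 4%:R / 5 : R) = - sin (2 * pi / 5).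
  rewrite -sinN -[RHS]sinD2pi; congr sin; lra.
rewrite /pentx /penty.
case: k => -[|[|[|[|[|k]]]]] //= _; rewrite ?mulr0 ?mul0r ?cos0 ?sin0 ?mulr1 //.
- by rewrite /ka; split=> //; field.
- by rewrite E2 cosD sinD /ka; split; nra.
- by rewrite c3 s3 E2 cosD sinD /ka; split; nra.
- by rewrite c4 s4 /ka; split; [field | rewrite mulrN1].
Qed.

(** The radius and sin (2 pi / 5) are absorbed into the frame, of which only linear independence is
    kept. *)
Lemma regular_pentagon_coords (v : 'I_5 -> 'rV[R]_3) : regular_pentagon v ->
  exists (c e1 e2 : 'rV[R]_3) (ka : R),
    [/\ 0 < ka, ka * ka = 1 - ka,
        forall y1 y2, y1 *: e1 + y2 *: e2 = 0 -> y1 = 0 /\ y2 = 0 &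
        forall k : 'I_5, v k = c + pentx ka k *: e1 + penty ka k *: e2].
Proof.
move=> [c [e1 [e2 [rho [rho0 e11 e22 e12 vE]]]]].
have [C0 S0 CS CC] := cos_sin_2pi5.
set S := sin (2 * pi / 5) in S0 CS.
exists c, (rho *: e1), ((rho * S) *: e2), (2 * cos (2 * pi / 5)); split.
- by rewrite mulr_gt0.
- by move: CC; lra.
- move=> y1 y2; rewrite !scalerA => y0; split.
    have := congr1 (dot e1) y0; rewrite dotDr !dotZr e11 e12 -[X in dot _ X](scale0r 0).
    by rewrite dotZr mul0r mulr0 addr0 mulr1 => /eqP; rewrite mulf_eq0 (gt_eqF rho0) orbF => /eqP.
  have := congr1 (dot e2) y0; rewrite dotDr !dotZr e22 dotC e12 -[X in dot _ X](scale0r 0).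
  rewrite dotZr mul0r mulr0 add0r mulr1 => /eqP.
  by rewrite !mulf_eq0 (gt_eqF rho0) (gt_eqF S0) !orbF => /eqP.
- move=> k; rewrite vE; have [-> ->] := cos_sin_pentagon k.
  by rewrite !scalerA; congr (_ + _ *: _ + _ *: _); rewrite -/S; ring.
Qed.

(** The dual basis is read off the columns of the inverse of the matrix with rows [e1], [e2],
    [e3]. *)
Lemma rV3_coords (e1 e2 e3 : 'rV[R]_3) :
  (forall y1 y2 y3, y1 *: e1 + y2 *: e2 + y3 *: e3 = 0 -> [/\ y1 = 0, y2 = 0 & y3 = 0]) ->
  exists d1 d2 d3 : 'rV[R]_3,
    (forall y1 y2 y3, let x := y1 *: e1 + y2 *: e2 + y3 *: e3 in
       [/\ dot d1 x = y1, dot d2 x = y2 & dot d3 x = y3]) /\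
    forall x, x = dot d1 x *: e1 + dot d2 x *: e2 + dot d3 x *: e3.
Proof.
move=> free.
pose B : 'M[R]_3 := \matrix_(i < 3) [:: e1; e2; e3]`_i.
have mulB (u : 'rV[R]_3) :
    u *m B = u 0 0 *: e1 + u 0 (inord 1) *: e2 + u 0 (inord 2) *: e3.
  rewrite mulmx_sum_row !big_ord_recr big_ord0 /= add0r !rowK /=.
  by congr (u 0 _ *: _ + u 0 _ *: _ + u 0 _ *: _); apply/val_inj; rewrite /= ?inordK.
have Bu : B \in unitmx.
  rewrite -row_free_unit -kermx_eq0; apply/eqP/row_matrixP => i; rewrite row0.
  have : row i (kermx B) *m B = 0 by apply/sub_kermxP; exact: row_sub.
  rewrite mulB => /free[u0 u1 u2]; apply/rowP => j; rewrite [RHS]mxE.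
  case: j => -[|[|[|j]]] // jj.
  - by rewrite -[RHS]u0; congr (row _ _ _ _); apply/val_inj.
  - by rewrite -[RHS]u1; congr (row _ _ _ _); apply/val_inj; rewrite /= inordK.
  - by rewrite -[RHS]u2; congr (row _ _ _ _); apply/val_inj; rewrite /= inordK.
pose dual j := (col j (invmx B))^T.
have dualE j x : dot (dual j) x = (x *m invmx B) 0 j.
  rewrite dotE mxE; apply: eq_bigr => i _.
  by rewrite /dual !mxE mulrC.
exists (dual 0), (dual (inord 1)), (dual (inord 2)); split; last first.
  by move=> x; rewrite !dualE -mulB mulmxKV.
move=> y1 y2 y3 x.
have -> : x = (\row_j [:: y1; y2; y3]`_j) *m B.
  by rewrite mulB !mxE /= !inordK.
by rewrite !dualE mulmxK// !mxE /= !inordK.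
Qed.

End PentagonCoordinates.

(** * Affine and convex hulls *)

Section Hulls.
Variables (R : realType) (d : nat).
Implicit Types (S : set 'rV[R]_d) (u p : 'rV[R]_d).

Lemma affine_hull_sub S u (b : R) : S `<=` [set x | dot u x = b] ->
  affine_hull S `<=` [set x | dot u x = b].
Proof.
move=> Sb _ [n [t [p [Sp t1 ->]]]] /=; rewrite dot_sumr.
by under eq_bigr => i _ do rewrite (Sb _ (Sp i)); rewrite -mulr_suml t1 mul1r.
Qed.

Lemma convex_hull_sub S u (b : R) : S `<=` [set x | dot u x <= b] ->
  convex_hull S `<=` [set x | dot u x <= b].
Proof.
move=> Sb _ [n [t [p [Sp t0 t1 ->]]]] /=; rewrite dot_sumr.
rewrite -[b]mul1r -t1 mulr_suml; apply: ler_sum => i _.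
by rewrite ler_wpM2l// Sb.
Qed.

Lemma affine_hull3 S p1 p2 p3 (t1 t2 t3 : R) : S p1 -> S p2 -> S p3 ->
  t1 + t2 + t3 = 1 -> affine_hull S (t1 *: p1 + t2 *: p2 + t3 *: p3).
Proof.
move=> S1 S2 S3 t; exists 3%N, (fun i => [:: t1; t2; t3]`_i), (fun i => [:: p1; p2; p3]`_i).
split; last 2 first.
- by rewrite !big_ord_recr big_ord0 /= add0r.
- by rewrite !big_ord_recr big_ord0 /= add0r.
by case=> -[|[|[|]]].
Qed.

Lemma affine_hull2 S p1 p2 (t1 t2 : R) : S p1 -> S p2 ->
  t1 + t2 = 1 -> affine_hull S (t1 *: p1 + t2 *: p2).
Proof.
move=> S1 S2 t; have := @affine_hull3 S p1 p2 p2 t1 t2 0 S1 S2 S2.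
by rewrite scale0r !addr0; apply.
Qed.

Lemma convex_hull_cons S n p0 (p : 'I_n -> 'rV[R]_d) (t0 : R) (t : 'I_n -> R) :
  S p0 -> (forall i, S (p i)) -> 0 <= t0 -> (forall i, 0 <= t i) ->
  t0 + \sum_i t i = 1 -> convex_hull S (t0 *: p0 + \sum_i t i *: p i).
Proof.
move=> S0 Sp t0_ge0 t_ge0 t1; exists n.+1.
exists (fun i => if unlift ord0 i is Some k then t k else t0).
exists (fun i => if unlift ord0 i is Some k then p k else p0).
split.
- by move=> i; case: (unlift ord0 i).
- by move=> i; case: (unlift ord0 i).
- rewrite big_ord_recl unlift_none; under eq_bigr => i _ do rewrite liftK.
  by [].
- rewrite big_ord_recl unlift_none; under [in RHS]eq_bigr => i _ do rewrite liftK.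
  by [].
Qed.

End Hulls.

(** * The planes of the pyramid as zero sets of affine functionals *)

Section Pyramid.
Variable R : realType.
Variables (c e1 e2 e3 d1 d2 d3 : 'rV[R]_3) (ka : R) (a : 'rV[R]_3) (v : 'I_5 -> 'rV[R]_3).
Hypothesis ka_gt0 : 0 < ka.
Hypothesis ka2 : ka * ka = 1 - ka.
Hypothesis vE : forall k : 'I_5, v k = c + pentx ka k *: e1 + penty ka k *: e2.
Hypothesis aE : a = c + e3.
Hypothesis dE : forall y1 y2 y3, let x := y1 *: e1 + y2 *: e2 + y3 *: e3 in
  [/\ dot d1 x = y1, dot d2 x = y2 & dot d3 x = y3].
Hypothesis xE : forall x, x = dot d1 x *: e1 + dot d2 x *: e2 + dot d3 x *: e3.

Definition pt (y1 y2 y3 : R) := c + (y1 *: e1 + y2 *: e2 + y3 *: e3).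

(* The i-th facet plane is [cf1 i * y1 + cf2 i * y2 + cf3 i * y3 = cf0 i], and  *)
(* the pyramid lies on the side [<].                                           *)
Definition cf1 i : R := [:: 0; 1; ka - 1; - (2 * ka); ka - 1; 1; 0]`_i.
Definition cf2 i : R := [:: 0; (2 - ka) / 2; (1 + 2 * ka) / 2; 0;
  - (1 + 2 * ka) / 2; - (2 - ka) / 2; 0]`_i.
Definition cf3 i : R := [:: 0; 1; 1; 1; 1; 1; -1]`_i.
Definition cf0 i : R := [:: 0; 1; 1; 1; 1; 1; 0]`_i.

Definition phi i y1 y2 y3 := cf1 i * y1 + cf2 i * y2 + cf3 i * y3 - cf0 i.

Definition normal i : 'rV[R]_3 := cf1 i *: d1 + cf2 i *: d2 + cf3 i *: d3.
Definition offset i : R := cf0 i + dot (normal i) c.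

Lemma dot_normal_pt i y1 y2 y3 :
  dot (normal i) (pt y1 y2 y3) = offset i + phi i y1 y2 y3.
Proof.
rewrite /pt dotDr /offset /phi; set x := _ + _ + _.
have -> : dot (normal i) x = cf1 i * y1 + cf2 i * y2 + cf3 i * y3.
  have [x1 x2 x3] := dE y1 y2 y3.
  by rewrite /normal dotC !dotDr !dotZr ![dot x _]dotC x1 x2 x3.
ring.
Qed.

Lemma normal_lt i y1 y2 y3 :
  (dot (normal i) (pt y1 y2 y3) < offset i) = (phi i y1 y2 y3 < 0).
Proof. by rewrite dot_normal_pt gtrDl. Qed.

Lemma normal_gt i y1 y2 y3 :
  (offset i < dot (normal i) (pt y1 y2 y3)) = (0 < phi i y1 y2 y3).
Proof. by rewrite dot_normal_pt ltrDl. Qed.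

Lemma normal_le i y1 y2 y3 :
  (dot (normal i) (pt y1 y2 y3) <= offset i) = (phi i y1 y2 y3 <= 0).
Proof. by rewrite dot_normal_pt gerDl. Qed.

Lemma normal_eq i y1 y2 y3 :
  (dot (normal i) (pt y1 y2 y3) == offset i) = (phi i y1 y2 y3 == 0).
Proof. by rewrite dot_normal_pt -subr_eq0 addrAC subrr add0r. Qed.

Lemma pt_coords x : exists y1 y2 y3, x = pt y1 y2 y3.
Proof.
exists (dot d1 (x - c)), (dot d2 (x - c)), (dot d3 (x - c)).
by rewrite /pt -xE addrC subrK.
Qed.

Lemma v_pt k : v k = pt (pentx ka k) (penty ka k) 0.
Proof. by rewrite vE /pt scale0r addr0 addrA. Qed.

Lemma a_pt : a = pt 0 0 1.
Proof. by rewrite aE /pt !scale0r !add0r scale1r. Qed.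

Lemma pt_sum n (t y1 y2 y3 : 'I_n -> R) :
  \sum_i t i *: pt (y1 i) (y2 i) (y3 i) =
  (\sum_i t i) *: c + (pt (\sum_i t i * y1 i) (\sum_i t i * y2 i) (\sum_i t i * y3 i) - c).
Proof.
rewrite /pt addrAC subrr add0r !scaler_suml -!big_split /=; apply: eq_bigr => i _.
by rewrite !scalerDr !scalerA.
Qed.

Lemma pt_comb3 (t1 t2 t3 x1 x2 x3 y1 y2 y3 z1 z2 z3 : R) : t1 + t2 + t3 = 1 ->
  t1 *: pt x1 x2 x3 + t2 *: pt y1 y2 y3 + t3 *: pt z1 z2 z3 =
  pt (t1 * x1 + t2 * y1 + t3 * z1) (t1 * x2 + t2 * y2 + t3 * z2)
     (t1 * x3 + t2 * y3 + t3 * z3).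
Proof.
move=> t.
have := @pt_sum 3 (fun i => [:: t1; t2; t3]`_i) (fun i => [:: x1; y1; z1]`_i)
  (fun i => [:: x2; y2; z2]`_i) (fun i => [:: x3; y3; z3]`_i).
by rewrite !big_ord_recr !big_ord0 /= !add0r t scale1r [c + _]addrC subrK.
Qed.

Lemma pt_comb2 (t1 t2 x1 x2 x3 y1 y2 y3 : R) : t1 + t2 = 1 ->
  t1 *: pt x1 x2 x3 + t2 *: pt y1 y2 y3 =
  pt (t1 * x1 + t2 * y1) (t1 * x2 + t2 * y2) (t1 * x3 + t2 * y3).
Proof.
move=> t; have := @pt_comb3 t1 t2 0 x1 x2 x3 y1 y2 y3 0 0 0.
by rewrite scale0r mul0r !addr0; apply.
Qed.

(** Rational bounds on (sqrt 5 - 1) / 2 that let [lra], for which [ka] is an indeterminate, settle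
    the numerical sign checks. *)
Lemma ka_bounds : 3 / 5 < ka < 31 / 50.
Proof.
apply/andP; split; rewrite ltNge; apply/negP => h.
  have : 0 <= (3 / 5 - ka) * ka by rewrite mulr_ge0 ?subr_ge0// ltW.
  by move: ka2; lra.
have : 0 <= (ka - 31 / 50) * ka by rewrite mulr_ge0 ?subr_ge0// ltW.
by move: ka2; lra.
Qed.

Lemma phi_apex i : (1 <= i <= 5)%N -> phi i 0 0 1 = 0.
Proof. by case: i => [|[|[|[|[|[|i]]]]]] // _; rewrite /phi /cf1 /cf2 /cf3 /cf0 /=; ring. Qed.

Lemma phi_base_edge i (k : 'I_5) : (1 <= i <= 5)%N -> k = i.-1 :> nat \/ k = (i %% 5)%N :> nat ->
  phi i (pentx ka k) (penty ka k) 0 = 0.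
Proof.
have ka2' : ka ^+ 2 = 1 - ka by rewrite expr2.
by case: i => [|[|[|[|[|[|i]]]]]] // _ [] -> /=;
  rewrite /phi /pentx /penty /cf1 /cf2 /cf3 /cf0 /=; field: ka2'.
Qed.

Lemma phi_vertices_le i (k : 'I_5) : (1 <= i <= 6)%N ->
  phi i (pentx ka k) (penty ka k) 0 <= 0.
Proof.
have /andP[k1 k2] := ka_bounds.
by case: i => [|[|[|[|[|[|[|i]]]]]]] // _; case: k => -[|[|[|[|[|k]]]]] //= _;
  rewrite /phi /pentx /penty /cf1 /cf2 /cf3 /cf0 /=; move: ka2 k1 k2; lra.
Qed.

(* Barycentric coordinates along the i-th edge: the opposite coordinates are   *)
(* the neighbouring functionals, normalized by [ka - 2].                       *)
Lemma phi_edge_coords i y1 y2 y3 : (1 <= i <= 5)%N -> phi i y1 y2 y3 = 0 ->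
  exists s t : R, [/\ s + t + y3 = 1,
    s * pentx ka i.-1 + t * pentx ka (i %% 5) = y1 &
    s * penty ka i.-1 + t * penty ka (i %% 5) = y2].
Proof.
move=> i15 fi.
(* The factor is the inverse of [ka - 2], since (ka - 2) (ka + 3) = -5. *)
pose u j := (- (3 + ka) / 5) * phi j y1 y2 y3.
exists (u ((i %% 5).+1)), (u (if i == 1%N then 5 else i.-1)%N).
have y3E : y3 = 1 - cf1 i * y1 - cf2 i * y2.
  by move: i15 fi; case: i => [|[|[|[|[|[|i]]]]]] // _; rewrite /phi /cf1 /cf2 /cf3 /cf0 /=; lra.
rewrite {}/u {}y3E {fi}.
have ka2' : ka ^+ 2 = 1 - ka by rewrite expr2.
by move: i15; case: i => [|[|[|[|[|[|i]]]]]] // _;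
  rewrite /phi /pentx /penty /cf1 /cf2 /cf3 /cf0 /=; split; field: ka2'.
Qed.

Definition face i := [set x | dot (normal i) x = offset i].

Lemma face_pt i y1 y2 y3 : face i (pt y1 y2 y3) <-> phi i y1 y2 y3 = 0.
Proof.
rewrite /face /=; split=> /eqP; first by rewrite normal_eq => /eqP.
by rewrite -normal_eq => /eqP.
Qed.

Lemma face6_pt y1 y2 y3 : face 6 (pt y1 y2 y3) <-> y3 = 0.
Proof. by rewrite face_pt /phi /cf1 /cf2 /cf3 /cf0 /=; split; lra. Qed.

Lemma base_edge_ends i x : (1 <= i <= 5)%N -> base_edge v i x ->
  exists2 k : 'I_5, x = v k & k = i.-1 :> nat \/ k = (i %% 5)%N :> nat.
Proof.
move=> /andP[i1 i5] [] ->.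
  by exists (inord i.-1) => //; left; rewrite inordK// prednK.
by exists (inord (i %% 5)) => //; right; rewrite inordK// ltn_mod.
Qed.

Lemma base_edge_face i : (1 <= i <= 5)%N -> base_edge v i `<=` face i.
Proof.
move=> i15 x /(base_edge_ends i15)[k -> ki]; rewrite v_pt.
by apply/face_pt/phi_base_edge.
Qed.

Lemma v_inord k : (k < 5)%N -> v (inord k) = pt (pentx ka k) (penty ka k) 0.
Proof. by move=> k5; rewrite v_pt inordK. Qed.

Lemma affine_hull_edge i : (1 <= i <= 5)%N ->
  affine_hull (base_edge v i) = face 6 `&` face i.
Proof.
move=> i15; apply/seteqP; split.
  rewrite subsetI; split; apply: affine_hull_sub; last exact: base_edge_face.
  by move=> x /(base_edge_ends i15)[k -> _]; rewrite v_pt; apply/face6_pt.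
move=> x; have [y1 [y2 [y3 ->]]] := pt_coords x.
move=> [/face6_pt-> /face_pt/(phi_edge_coords i15)[s [t [st <- <-]]]].
rewrite addr0 in st.
have -> : 0 = s * 0 + t * 0 :> R by rewrite !mulr0 addr0.
rewrite -pt_comb2// -!v_inord ?ltn_mod//; last by move: i15; lia.
by apply: affine_hull2 => //; [left|right].
Qed.

Lemma affine_hull_side i : (1 <= i <= 5)%N ->
  affine_hull (a |` base_edge v i) = face i.
Proof.
move=> i15; apply/seteqP; split.
  apply: affine_hull_sub => x [->|]; last exact: base_edge_face.
  by rewrite a_pt; apply/face_pt/phi_apex.
move=> x; have [y1 [y2 [y3 ->]]] := pt_coords x.
move=> /face_pt/(phi_edge_coords i15)[s [t [st <- <-]]].
have -> : pt (s * pentx ka i.-1 + t * pentx ka (i %% 5))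
   (s * penty ka i.-1 + t * penty ka (i %% 5)) y3 =
   s *: pt (pentx ka i.-1) (penty ka i.-1) 0 +
   t *: pt (pentx ka (i %% 5)) (penty ka (i %% 5)) 0 + y3 *: pt 0 0 1.
  by rewrite pt_comb3// !mulr0 !addr0 add0r mulr1.
rewrite -!v_inord ?ltn_mod//; last by move: i15; lia.
rewrite -a_pt; apply: affine_hull3 => //; last by left.
- by right; left.
- by right; right.
Qed.

Lemma base_plane_pt y1 y2 : base_plane v (pt y1 y2 0).
Proof.
(* Barycentric coordinates on the vertices 0, 1, 4: [s] solves 1 - y1 = s (2 - ka) / 2. *)
pose s := (1 - y1) * (2 * (3 + ka) / 5).
have -> : pt y1 y2 0 = (1 - s) *: v (inord 0) + (s + y2) / 2 *: v (inord 1) +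
    (s - y2) / 2 *: v (inord 4).
  rewrite !v_inord// pt_comb3; last by rewrite /s; field.
  have ka2' : ka ^+ 2 = 1 - ka by rewrite expr2.
  by rewrite /pentx /penty /=; congr pt; rewrite /s; field: ka2'.
apply: affine_hull3; [by exists (inord 0)|by exists (inord 1)|by exists (inord 4)|].
by rewrite /s; field.
Qed.

Lemma base_plane_face : base_plane v = face 6.
Proof.
apply/seteqP; split.
  by apply: affine_hull_sub => _ [k _ <-]; rewrite v_pt; apply/face6_pt.
by move=> x; have [y1 [y2 [y3 ->]]] := pt_coords x; move=> /face6_pt->; apply: base_plane_pt.
Qed.

Lemma pyramid_plane_face i : (1 <= i <= 6)%N -> pyramid_plane a v i = face i.
Proof.
move=> i16; rewrite /pyramid_plane; case: eqP => [->|i6]; first exact: base_plane_face.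
by apply: affine_hull_side; move: i16 i6; lia.
Qed.

(** * The interiors of the pyramid and of the pentagon *)

Lemma phi_sum y1 y2 y3 :
  phi 1 y1 y2 y3 + phi 2 y1 y2 y3 + phi 3 y1 y2 y3 + phi 4 y1 y2 y3 + phi 5 y1 y2 y3
  = - 5 * (1 - y3).
Proof. by rewrite /phi /cf1 /cf2 /cf3 /cf0 /=; field. Qed.

(* Wachspress coordinates: the weight of a vertex of the pentagon is the       *)
(* product of the functionals of the three edges that avoid it.                *)
Lemma wachspress y1 y2 y3 : (forall i, (1 <= i <= 5)%N -> phi i y1 y2 y3 < 0) ->
  exists w : 'I_5 -> R, [/\ forall k, 0 <= w k, \sum_k w k = 1 - y3,
    \sum_k w k * pentx ka k = y1 & \sum_k w k * penty ka k = y2].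
Proof.
move=> f0.
have [F1 F2 F3 F4 F5] : [/\ 0 < - phi 1 y1 y2 y3, 0 < - phi 2 y1 y2 y3,
    0 < - phi 3 y1 y2 y3, 0 < - phi 4 y1 y2 y3 & 0 < - phi 5 y1 y2 y3].
  by split; rewrite oppr_gt0 f0.
have s0 : 0 < 1 - y3 by have := phi_sum y1 y2 y3; lra.
have ka2' : ka ^+ 2 = 1 - ka by rewrite expr2.
pose l k := let f i := - phi i y1 y2 y3 in
  [:: f 2 * f 3 * f 4; f 3 * f 4 * f 5; f 4 * f 5 * f 1;
      f 5 * f 1 * f 2; f 1 * f 2 * f 3]`_k.
pose L := \sum_(k < 5) l k.
have l0 (k : 'I_5) : 0 < l k.
  by case: k => -[|[|[|[|[|k]]]]] //= _; rewrite /l /= !mulr_gt0.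
have L0 : 0 < L by rewrite /L !big_ord_recr big_ord0 /= add0r !addr_gt0 ?(l0 (Ordinal _)).
(* Linear precision of the Wachspress weights, homogenized so that it holds in each horizontal
   section, where [1 - y3] is the scale of the pentagon. *)
have E1 : (1 - y3) * (\sum_(k < 5) l k * pentx ka k) = y1 * L.
  rewrite /L !big_ord_recr !big_ord0 /= /l /= /phi /pentx /penty /cf1 /cf2 /cf3 /cf0 /=.
  by field: ka2'.
have E2 : (1 - y3) * (\sum_(k < 5) l k * penty ka k) = y2 * L.
  rewrite /L !big_ord_recr !big_ord0 /= /l /= /phi /pentx /penty /cf1 /cf2 /cf3 /cf0 /=.
  by field: ka2'.
exists (fun k => (1 - y3) / L * l k); split.
- by move=> k; rewrite mulr_ge0 ?divr_ge0 ?(ltW (l0 k)) ?(ltW s0) ?(ltW L0).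
- by rewrite -mulr_sumr divfK// gt_eqF.
- under eq_bigr => k _ do rewrite -(mulrA ((1 - y3) / L)).
  by rewrite -mulr_sumr mulrAC E1 mulfK// gt_eqF.
- under eq_bigr => k _ do rewrite -(mulrA ((1 - y3) / L)).
  by rewrite -mulr_sumr mulrAC E2 mulfK// gt_eqF.
Qed.

Lemma open_dot_lt (N : nat -> 'rV[R]_3) (b : nat -> R) (s : seq nat) :
  open [set x | {in s, forall i, dot (N i) x < b i}].
Proof.
elim: s => [|i s IH].
  rewrite (_ : [set _ | _] = setT); first exact: openT.
  by apply/seteqP; split.
rewrite (_ : [set _ | _] = [set x | dot (N i) x < b i] `&`
    [set x | {in s, forall j, dot (N j) x < b j}]).
  apply: openI => //; apply: (@open_comp _ _ (dot (N i)) [set z | z < b i]); last exact: open_lt.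
  by move=> x _; exact: dot_continuous.
apply/seteqP; split => x /=.
  by move=> xs; split => [|j js]; apply: xs; rewrite inE ?eqxx ?js ?orbT.
by move=> [xi xs] j; rewrite inE => /orP[/eqP->|/xs].
Qed.

Lemma cell_pt E idx s y1 y2 y3 : E (pt y1 y2 y3) ->
  {in idx, forall i, if i \in s then 0 < phi i y1 y2 y3 else phi i y1 y2 y3 < 0} ->
  cell E normal offset idx s (pt y1 y2 y3).
Proof. by move=> Ey sy; split => // i ii; rewrite normal_lt normal_gt; apply: sy. Qed.

Lemma cell0_lt E idx x i : cell E normal offset idx [::] x -> i \in idx ->
  dot (normal i) x < offset i.
Proof. by move=> [_ /(_ i)] /[apply]. Qed.

Lemma hull_le i : (1 <= i <= 6)%N ->
  convex_hull (a |` range v) `<=` [set x | dot (normal i) x <= offset i].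
Proof.
move=> i16; apply: convex_hull_sub => x [->|[k _ <-]] /=.
  rewrite a_pt normal_le; move: i16.
  by case: i => [|[|[|[|[|[|[|i]]]]]]] // _; rewrite /phi /cf1 /cf2 /cf3 /cf0 /=; lra.
by rewrite v_pt normal_le phi_vertices_le.
Qed.

Lemma pentagon_hull y1 y2 : (forall i, (1 <= i <= 5)%N -> phi i y1 y2 0 < 0) ->
  convex_hull (range v) (pt y1 y2 0).
Proof.
move=> /wachspress[w [w0]]; rewrite subr0 => w1 <- <-.
exists 5%N, w, v; split => //.
apply/esym; under eq_bigr => k _ do rewrite v_pt.
rewrite pt_sum w1 scale1r [c + _]addrC subrK.
by rewrite -[\sum_i w i * 0]mulr_suml mulr0.
Qed.

Lemma pyramid_hull y1 y2 y3 : (forall i, (1 <= i <= 6)%N -> phi i y1 y2 y3 < 0) ->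
  convex_hull (a |` range v) (pt y1 y2 y3).
Proof.
move=> f0; have y3_gt0 : 0 < y3.
  by have := f0 6 isT; rewrite /phi /cf1 /cf2 /cf3 /cf0 /=; lra.
have [|w [w0 w1 E1 E2]] := @wachspress y1 y2 y3.
  by move=> i i15; apply: f0; move: i15; lia.
have -> : pt y1 y2 y3 = y3 *: a + \sum_k w k *: v k.
  under eq_bigr => k _ do rewrite v_pt.
  rewrite pt_sum w1 E1 E2 aE /pt big1 => [|k _]; last by rewrite mulr0.
  by apply/rowP => j; rewrite !mxE; ring.
apply: convex_hull_cons => //; first by left.
- by move=> k; right; exists k.
- exact: ltW.
- by rewrite w1; lra.
Qed.

(** The hull satisfies the six weak inequalities, and none is an equality at an interior point;
    conversely the cell is open and lies in the hull by [pyramid_hull]. *)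
Lemma pyramid_interiorE :
  pyramid_interior a v = cell setT normal offset (iota 1 6) [::].
Proof.
have int_open : open (cell setT normal offset (iota 1 6) [::]).
  rewrite (_ : cell _ _ _ _ _ =
      [set x | {in iota 1 6, forall i, dot (normal i) x < offset i}]).
    exact: open_dot_lt.
  by apply/seteqP; split => x; [case | split].
rewrite /pyramid_interior; apply/seteqP; split.
  move=> x xint; split => // i ii; rewrite in_nil.
  have i16 : (1 <= i <= 6)%N by move: ii; rewrite mem_iota; lia.
  have := hull_le i16 (interior_subset xint); rewrite /= le_eqVlt => /orP[/eqP xi|//].
  (* A point strictly inside the i-th half-space: the apex, or the centre of the base. If [x] were
     on the i-th plane, moving it slightly away from [z] would leave the half-space but not the
     hull. *)
  pose z := if i == 6%N then pt 0 0 1 else pt 0 0 0.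
  have zi : dot (normal i) z < offset i.
    rewrite /z; case: eqP i16 => [->|]; rewrite normal_lt.
      by rewrite /phi /cf1 /cf2 /cf3 /cf0 /=; lra.
    by case: i {ii xi z} => [|[|[|[|[|[|[|i]]]]]]] // _ _; rewrite /phi /cf1 /cf2 /cf3 /cf0 /=; lra.
  have /(_ 0) gc : continuous (fun t : R => x + t *: (x - z)).
    move=> t; apply: cvgD; first exact: cvg_cst.
    by apply: cvgZr_tmp; exact: cvg_id.
  have : \forall t \near (0 : R), convex_hull (a |` range v) (x + t *: (x - z)).
    by apply: gc; rewrite scale0r addr0.
  move=> [e /= e0 /(_ (e / 2))].
  rewrite /= sub0r normrN gtr0_norm ?divr_gt0// => /(_ _)/(hull_le i16).
  rewrite /= dotDr dotZr -scaleN1r dotDr dotZr xi mulN1r.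
  have : 0 < e / 2 * (offset i - dot (normal i) z) by rewrite mulr_gt0 ?divr_gt0 ?subr_gt0.
  by move=> + H; have := H _; lra.
rewrite -open_subsetE// => x; have [y1 [y2 [y3 ->]]] := pt_coords x.
move=> xc; apply: pyramid_hull => i i16.
by rewrite -normal_lt; apply: cell0_lt xc _; rewrite mem_iota; move: i16; lia.
Qed.

Lemma pentagon_arrE :
  pentagon_arr v = [set face 6 `&` face i | i in [set` iota 1 5]].
Proof.
apply/seteqP; split => _ [i i15 <-]; exists i.
- by have : i \in iota 1 5 by rewrite mem_iota; move: i15 => /=; lia.
- by rewrite affine_hull_edge.
- by move: (i15 : i \in iota 1 5); rewrite mem_iota /=; lia.
- by rewrite affine_hull_edge//; move: (i15 : i \in iota 1 5); rewrite mem_iota; lia.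
Qed.

(** The pentagon is flat in space, so the strict inequalities come from removing the edge lines, not
    from a topological interior. *)
Lemma pentagon_interiorE :
  pentagon_interior v = cell (face 6) normal offset (iota 1 5) [::].
Proof.
apply/seteqP; split => x; have [y1 [y2 [y3 ->]]] := pt_coords x.
  move=> [xh xn].
  have x6 : face 6 (pt y1 y2 y3).
    rewrite -base_plane_face; case: xh => n [t [p [Sp _ t1 xE']]].
    by exists n, t, p.
  split => // i ii; rewrite in_nil.
  have i15 : (1 <= i <= 5)%N by move: ii; rewrite mem_iota; lia.
  have : dot (normal i) (pt y1 y2 y3) <= offset i.
    apply: hull_le; first by move: i15; lia.
    case: xh => n [t [p [Sp t0 t1 xE']]]; exists n, t, p.
    by split => // k; right.
  rewrite le_eqVlt => /orP[/eqP xi|//]; exfalso; apply: xn.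
  by rewrite pentagon_arrE; exists (face 6 `&` face i) => //; exists i.
move=> xc; have := xc.1 => /face6_pt y3E; rewrite {}y3E in xc *; split.
  apply: pentagon_hull => i i15; rewrite -normal_lt.
  by apply: cell0_lt xc _; rewrite mem_iota; move: i15; lia.
rewrite pentagon_arrE => -[_ [i ii <-] [_]] /=.
by have := cell0_lt xc ii; rewrite /face /= => /[swap] ->; rewrite ltxx.
Qed.

(** * Realizable sign vectors *)

(* The k-th of the 22 cones with apex [a] contains the ray from [a] with       *)
(* direction [mu *: (v_j - c) - sigma *: (a - c)]; it meets the base plane when *)
(* [sigma = 1].                                                                *)
Definition ray_mu (k : nat) : R :=
  (0 :: nseq 5 (-1) ++ nseq 5 2 ++ nseq 5 (-3) ++ nseq 5 1)`_k.
Definition ray_vertex (k : nat) : nat :=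
  nth 0 [:: 0; 3; 4; 0; 1; 2; 1; 2; 3; 4; 0; 4; 0; 1; 2; 3; 2; 3; 4; 0; 1; 0]%N k.
Definition ray_sigma (k : nat) : R := if (k < 16)%N then 1 else -1.

Definition ray_pt (t : R) (k : nat) : 'rV[R]_3 :=
  pt (t * (ray_mu k * pentx ka (ray_vertex k)))
     (t * (ray_mu k * penty ka (ray_vertex k))) (1 - t * ray_sigma k).

(** The side functionals vanish at the apex, so along a ray they scale by [t] and their signs do not
    depend on it. What remains is a table of 22 times 5 signs. *)
Lemma phi_ray t k i : 0 < t -> (k < 22)%N -> i \in iota 1 5 -> forall f,
  f = phi i (t * (ray_mu k * pentx ka (ray_vertex k)))
        (t * (ray_mu k * penty ka (ray_vertex k))) (1 - t * ray_sigma k) ->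
  if i \in nth [::] strings22 k then 0 < f else f < 0.
Proof.
move=> t0 k22 ii f fE.
have {f fE}-> : f = t * phi i (ray_mu k * pentx ka (ray_vertex k))
    (ray_mu k * penty ka (ray_vertex k)) (1 - ray_sigma k).
  by rewrite {}fE; case: i ii => [|[|[|[|[|[|i]]]]]] // _;
    rewrite /phi /cf1 /cf2 /cf3 /cf0 /=; ring.
rewrite pmulr_rgt0// pmulr_rlt0//.
have /andP[k1 k2] := ka_bounds; move: k22 ii.
do 22![case: k => [_|k];
  first by case: i => [|[|[|[|[|[|i]]]]]] // _; rewrite /= ?inE /=;
  rewrite /phi /cf1 /cf2 /cf3 /cf0 /ray_mu /ray_vertex /ray_sigma /pentx /penty /=;
  move: ka2 k1 k2; lra].
by [].
Qed.

Lemma cell_ray E idx t k s : 0 < t -> (k < 22)%N -> E (ray_pt t k) ->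
  {in idx, forall i, i \in iota 1 5 /\ (i \in s) = (i \in nth [::] strings22 k)} ->
  cell E normal offset idx s (ray_pt t k).
Proof.
move=> t0 k22 Ey sk; apply: cell_pt => // i ii.
by have [i15 ->] := sk i ii; exact: (phi_ray t0 k22 i15 erefl).
Qed.

Lemma strings16_22 s : s \in strings16 ->
  exists k, [/\ (k < 16)%N, (k < 22)%N & s = nth [::] strings22 k].
Proof.
move=> s16; exists (index s strings16).
have k16 : (index s strings16 < 16)%N by rewrite -[16%N]/(size strings16) index_mem.
split => //; first exact: ltn_trans k16 _.
by rewrite /strings22 nth_cat k16 nth_index.
Qed.

Lemma strings22_nth s : s \in strings22 ->
  exists2 k, (k < 22)%N & s = nth [::] strings22 k.
Proof.
by move=> s22; exists (index s strings22); rewrite ?nth_index// -[22%N]/(size strings22) index_mem.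
Qed.

Lemma cell22_neq0 s : s \in strings22 ->
  cell setT normal offset (iota 1 5) s !=set0.
Proof.
move=> /strings22_nth[k k22 ->]; exists (ray_pt 1 k).
by apply: cell_ray => // i ->.
Qed.

Lemma cell16_neq0 s : s \in strings16 ->
  cell (face 6) normal offset (iota 1 5) s !=set0.
Proof.
move=> /strings16_22[k [k16 k22 ->]]; exists (ray_pt 1 k).
apply: cell_ray => //.
by apply/face6_pt; rewrite /ray_sigma k16; lra.
Qed.

Lemma iota16_case i : i \in iota 1 6 -> i = 6%N \/ i \in iota 1 5.
Proof. by rewrite !mem_iota; lia. Qed.

Lemma phi6 y1 y2 y3 : phi 6 y1 y2 y3 = - y3.
Proof. by rewrite /phi /cf1 /cf2 /cf3 /cf0 /=; ring. Qed.

Lemma strings22_no6 : all (fun s => 6 \notin s)%N strings22.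
Proof. by []. Qed.

Lemma cell38_neq0 s : s \in strings38 ->
  cell setT normal offset (iota 1 6) s !=set0.
Proof.
rewrite /strings38 mem_cat => /orP[/mapP[t /strings16_22[k [k16 k22 ->]] ->]|].
  (* The first 16 rays cross the base plane at [t = 1], so [t = 2] lies beyond it; below,
     [t = 1 / 2] lies on the side of the apex for all 22 rays. *)
  exists (ray_pt 2 k); apply: cell_pt => // i /iota16_case[->|i15].
    by rewrite mem_rcons mem_head phi6 /ray_sigma k16; lra.
  rewrite mem_rcons inE; have -> : (i == 6) = false by move: i15; rewrite mem_iota; lia.
  by apply: (phi_ray _ k22 i15 erefl).
move=> s22; have /negbTE s6 := allP strings22_no6 _ s22.
move: s22 s6 => /strings22_nth[k k22 ->] s6.
exists (ray_pt (1 / 2) k); apply: cell_pt => // i /iota16_case[->|i15].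
  by rewrite s6 phi6 /ray_sigma; case: ifP => _; lra.
by apply: (phi_ray _ k22 i15 erefl); lra.
Qed.

(** The linear parts in [y1], [y2] are sampled at angles 2 pi / 5 apart, so cos (t - u) + cos (t +
    u) = 2 cos u cos t applies with 2 cos u = [ka]; the last term corrects for the constants. *)
Lemma phi_relation y1 y2 y3 :
  let f i := phi i y1 y2 y3 in
  [/\ ka * f 1 = f 5 + f 2 + (2 - ka) * (1 - y3),
      ka * f 2 = f 1 + f 3 + (2 - ka) * (1 - y3),
      ka * f 3 = f 2 + f 4 + (2 - ka) * (1 - y3),
      ka * f 4 = f 3 + f 5 + (2 - ka) * (1 - y3) &
      ka * f 5 = f 4 + f 1 + (2 - ka) * (1 - y3)].
Proof.
have ka2' : ka ^+ 2 = 1 - ka by rewrite expr2.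
by rewrite /phi /cf1 /cf2 /cf3 /cf0 /=; split; field: ka2'.
Qed.

(** Since 0 < [ka] < 1, each product of [ka] with a functional lies strictly between 0 and the
    functional. These bounds, [phi_sum] and [phi_relation] refute every sign vector outside the
    list, and outside the first 16 when the point is below the apex. *)
Lemma positive_strings y1 y2 y3 (P := [seq i <- iota 1 5 | 0 < phi i y1 y2 y3]) :
  {in iota 1 5, forall i, phi i y1 y2 y3 != 0} ->
  P \in strings22 /\ (0 < 1 - y3 -> P \in strings16).
Proof.
move=> f0.
have kk : 0 < 1 - ka by have /andP[_] := ka_bounds; lra.
have sign i : i \in iota 1 5 -> exists b : bool, (0 < phi i y1 y2 y3) = b /\
    if b then 0 < ka * phi i y1 y2 y3 < phi i y1 y2 y3
         else phi i y1 y2 y3 < ka * phi i y1 y2 y3 < 0.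
  move=> /f0; rewrite neq_lt => /orP[fi|fi].
    exists false; split; first by apply/negbTE; rewrite -leNgt ltW.
    have : 0 < (1 - ka) * - phi i y1 y2 y3 by rewrite mulr_gt0// oppr_gt0.
    by rewrite pmulr_rlt0// fi andbT /=; lra.
  exists true; split; first by [].
  have : 0 < (1 - ka) * phi i y1 y2 y3 by rewrite mulr_gt0.
  by rewrite [0 < ka * _]pmulr_rgt0// fi /=; lra.
have s_gt0 : 0 < 1 - y3 -> 0 < ka * (1 - y3) < 1 - y3.
  move=> s0; have : 0 < (1 - ka) * (1 - y3) by rewrite mulr_gt0.
  by rewrite [0 < ka * _]pmulr_rgt0// s0 /=; lra.
have [b1 [B1 S1]] := sign 1%N isT; have [b2 [B2 S2]] := sign 2%N isT.
have [b3 [B3 S3]] := sign 3%N isT; have [b4 [B4 S4]] := sign 4%N isT.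
have [b5 [B5 S5]] := sign 5%N isT.
rewrite {}/P /= B1 B2 B3 B4 B5.
have := phi_relation y1 y2 y3; have := phi_sum y1 y2 y3.
move: S1 S2 S3 S4 S5 s_gt0 => {sign f0 B1 B2 B3 B4 B5}.
rewrite /=; set s := 1 - y3.
move: (phi 1 y1 y2 y3) (phi 2 y1 y2 y3) (phi 3 y1 y2 y3) (phi 4 y1 y2 y3) (phi 5 y1 y2 y3).
move=> F1 F2 F3 F4 F5 S1 S2 S3 S4 S5 s_gt0 Fs [r1 r2 r3 r4 r5].
rewrite mulrBl in r1 r2 r3 r4 r5.
(* With the products turned into fresh variables, all 32 cases are linear. *)
move: (ka * F1) (ka * F2) (ka * F3) (ka * F4) (ka * F5) (ka * s) S1 S2 S3 S4 S5 s_gt0 r1 r2 r3 r4 r5.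
move=> G1 G2 G3 G4 G5 S S1 S2 S3 S4 S5 s_gt0 r1 r2 r3 r4 r5.
by case: b1 b2 b3 b4 b5 S1 S2 S3 S4 S5 => -[] [] [] [] /andP[? ?] /andP[? ?] /andP[? ?]
  /andP[? ?] /andP[? ?]; split => //; try (move=> /s_gt0 /andP[? ?]); exfalso; lra.
Qed.

Lemma cell_positive E idx y1 y2 y3 : E (pt y1 y2 y3) ->
  {in idx, forall i, phi i y1 y2 y3 != 0} ->
  cell E normal offset idx [seq i <- idx | 0 < phi i y1 y2 y3] (pt y1 y2 y3).
Proof.
move=> Ey f0; apply: cell_pt => // i ii; rewrite mem_filter ii andbT.
by case: ltgtP (f0 i ii).
Qed.

Lemma cell22_cover x : {in iota 1 5, forall i, dot (normal i) x != offset i} ->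
  exists2 s, s \in strings22 & cell setT normal offset (iota 1 5) s x.
Proof.
have [y1 [y2 [y3 ->]]] := pt_coords x => xi.
have f0 : {in iota 1 5, forall i, phi i y1 y2 y3 != 0}.
  by move=> i /xi; rewrite normal_eq.
exists [seq i <- iota 1 5 | 0 < phi i y1 y2 y3]; last exact: cell_positive.
by have [] := positive_strings f0.
Qed.

Lemma cell16_cover x : face 6 x ->
  {in iota 1 5, forall i, dot (normal i) x != offset i} ->
  exists2 s, s \in strings16 & cell (face 6) normal offset (iota 1 5) s x.
Proof.
have [y1 [y2 [y3 ->]]] := pt_coords x => x6 xi.
have f0 : {in iota 1 5, forall i, phi i y1 y2 y3 != 0}.
  by move=> i /xi; rewrite normal_eq.
exists [seq i <- iota 1 5 | 0 < phi i y1 y2 y3]; last exact: cell_positive.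
by have [_] := positive_strings f0; apply; move/face6_pt: x6 => ->; rewrite subr0.
Qed.

Lemma cell38_cover x : {in iota 1 6, forall i, dot (normal i) x != offset i} ->
  exists2 s, s \in strings38 & cell setT normal offset (iota 1 6) s x.
Proof.
have [y1 [y2 [y3 ->]]] := pt_coords x => xi.
have f0 : {in iota 1 6, forall i, phi i y1 y2 y3 != 0}.
  by move=> i /xi; rewrite normal_eq.
exists [seq i <- iota 1 6 | 0 < phi i y1 y2 y3]; last exact: cell_positive.
have [|P22 P16] := @positive_strings y1 y2 y3.
  by move=> i i5; apply: f0; move: i5; rewrite !mem_iota; lia.
have -> : [seq i <- iota 1 6 | 0 < phi i y1 y2 y3] =
    [seq i <- iota 1 5 | 0 < phi i y1 y2 y3] ++ (if y3 < 0 then [:: 6%N] else [::]).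
  rewrite -[iota 1 6]/(iota 1 5 ++ [:: 6%N]) filter_cat; congr cat.
  by rewrite [LHS]/= phi6 oppr_gt0.
rewrite /strings38 mem_cat; case: ifP => y30.
  apply/orP; left; apply/mapP; eexists; last exact: cats1.
  by apply: P16; lra.
by rewrite cats0 P22 orbT.
Qed.

(** * The full, deleted and restricted arrangements *)

Let h := pyramid_plane a v.

Lemma planeE : {in iota 1 6, forall i, h i = setT `&` [set x | dot (normal i) x = offset i]}.
Proof.
move=> i i16; rewrite setTI; apply: pyramid_plane_face.
by move: i16; rewrite mem_iota; lia.
Qed.

Lemma edge_lineE : {in iota 1 5, forall i,
  h 6 `&` h i = face 6 `&` [set x | dot (normal i) x = offset i]}.
Proof.
by move=> i i15; rewrite !planeE ?setTI//; move: i15; rewrite !mem_iota; lia.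
Qed.

Lemma face_line i x y (t : R) : face i x -> face i y -> face i ((1 - t) *: x + t *: y).
Proof. by rewrite /face /= dot_line => -> ->; ring. Qed.

Lemma pyramid_arrE : pyramid_arr a v = [set h i | i in [set` iota 1 6]].
Proof.
congr image; apply/seteqP; split => i.
  by move=> i16; have : i \in iota 1 6 by rewrite mem_iota; move: i16 => /=; lia.
by move=> i16; move: (i16 : i \in iota 1 6); rewrite mem_iota /=; lia.
Qed.

Lemma pyramid_arrangement :
  [/\ {in iota 1 6 &, injective h},
      regions setT (pyramid_arr a v) (pyramid_interior a v),
      exists r : 'I_38 -> set 'rV[R]_3, region_ordering setT (pyramid_arr a v) h
        (pyramid_interior a v) strings38 r &
      forall r : 'I_38 -> set 'rV[R]_3, region_ordering setT (pyramid_arr a v) h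
        (pyramid_interior a v) strings38 r ->
      varchenko setT (pyramid_arr a v) r = string_mx (iota 1 6) strings38 38].
Proof.
rewrite pyramid_arrE pyramid_interiorE; apply: cell_arrangement => //.
- exact: planeE.
- exact: strings_inj.
- by apply/allP.
- exact: cell38_neq0.
- by move=> x _; apply: cell38_cover.
- exact: cell38_neq0.
Qed.

(** Removing the plane [h 6] from the set removes only the index 6 because the six planes are
    distinct. *)
Lemma deleted_arrE :
  pyramid_arr a v `\ h 6 = [set h i | i in [set` iota 1 5]].
Proof.
have [hinj _ _ _] := pyramid_arrangement.
rewrite pyramid_arrE; apply/seteqP; split => x.
  move=> [[i i16 <-] i6]; exists i => //.
  by have [iE|//] := iota16_case i16; case: i6; rewrite iE.
move=> [i i15 <-]; have i16 : i \in iota 1 6.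
  by move: (i15 : i \in iota 1 5); rewrite !mem_iota; lia.
split; first by exists i.
move=> /(hinj i 6%N i16 isT) iE; by move: i15; rewrite iE.
Qed.

Lemma cone_arrangement :
  (exists r : 'I_22 -> set 'rV[R]_3, region_ordering setT (pyramid_arr a v `\ h 6) h
     (pyramid_interior a v) strings22 r) /\
  forall r : 'I_22 -> set 'rV[R]_3, region_ordering setT (pyramid_arr a v `\ h 6) h
     (pyramid_interior a v) strings22 r ->
  varchenko setT (pyramid_arr a v `\ h 6) r = string_mx (iota 1 5) strings22 22.
Proof.
have := @cell_arrangement R 3 setT normal offset (iota 1 5) h strings22.
rewrite deleted_arrE pyramid_interiorE.
move=> /(_ _ _ _ _ _ _ _ _ _ (cell setT normal offset (iota 1 6) [::]) 22%N _ _ erefl).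
case=> //.
- by move=> i i15; apply: planeE; move: i15; rewrite !mem_iota; lia.
- exact: strings_inj.
- by apply/allP.
- exact: cell22_neq0.
- by move=> x _; apply: cell22_cover.
- move=> x [_ xs]; split => // i i15; apply: xs.
  by move: i15; rewrite !mem_iota; lia.
- exact: cell38_neq0.
Qed.

Lemma restricted_arrE : arr_restriction (pyramid_arr a v) (h 6) =
  [set h 6 `&` h i | i in [set` iota 1 5]].
Proof.
rewrite /arr_restriction deleted_arrE; apply/seteqP; split => x.
  by move=> [[_ [i i15 <-] <-] _]; exists i.
move=> [i i15 <-]; split; first by exists (h i) => //; exists i.
have i15' : (1 <= i <= 5)%N by move: (i15 : i \in iota 1 5); rewrite mem_iota; lia.
(* A vertex of the pentagon lies on both planes, so discarding empty intersections loses no line. *)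
have vi : base_edge v i (v (inord i.-1)) by left.
move=> E0; have : (h 6 `&` h i) (v (inord i.-1)); last by rewrite E0.
rewrite edge_lineE//; split; last exact: base_edge_face vi.
by rewrite -base_plane_face v_pt; exact: base_plane_pt.
Qed.

Lemma pentagon_arrangement :
  arr_restriction (pyramid_arr a v) (h 6) = pentagon_arr v /\
  [/\ regions (h 6) (arr_restriction (pyramid_arr a v) (h 6)) (pentagon_interior v),
      exists r : 'I_16 -> set 'rV[R]_3, region_ordering (h 6)
        (arr_restriction (pyramid_arr a v) (h 6)) (fun i => h 6 `&` h i)
        (pentagon_interior v) strings16 r &
      forall r : 'I_16 -> set 'rV[R]_3, region_ordering (h 6)
        (arr_restriction (pyramid_arr a v) (h 6)) (fun i => h 6 `&` h i)
        (pentagon_interior v) strings16 r ->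
      varchenko (h 6) (arr_restriction (pyramid_arr a v) (h 6)) r =
        string_mx (iota 1 5) strings16 16].
Proof.
have h6 : h 6 = face 6 by rewrite planeE// setTI.
split.
  rewrite restricted_arrE pentagon_arrE; apply/seteqP.
  by split => _ [i i15 <-]; exists i => //; rewrite (edge_lineE i15).
have := @cell_arrangement R 3 (face 6) normal offset (iota 1 5)
  (fun i => h 6 `&` h i) strings16.
rewrite restricted_arrE pentagon_interiorE h6.
move=> /(_ _ _ _ _ _ _ _ _ _ (cell (face 6) normal offset (iota 1 5) [::]) 16%N _ _ erefl)[] //.
- exact: face_line.
- by move=> i i15; rewrite -(edge_lineE i15) h6.
- exact: strings_inj.
- by apply/allP.
- exact: cell16_neq0.
- exact: cell16_cover.
- exact: cell16_neq0.
Qed.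
End Pyramid.

Lemma pyramid_coords (R : realType) (a : 'rV[R]_3) (v : 'I_5 -> 'rV[R]_3) :
  regular_pentagon v -> ~ base_plane v a ->
  exists (c e1 e2 e3 d1 d2 d3 : 'rV[R]_3) (ka : R),
    [/\ 0 < ka /\ ka * ka = 1 - ka,
        forall k : 'I_5, v k = c + pentx ka k *: e1 + penty ka k *: e2,
        a = c + e3,
        forall y1 y2 y3, let x := y1 *: e1 + y2 *: e2 + y3 *: e3 in
          [/\ dot d1 x = y1, dot d2 x = y2 & dot d3 x = y3] &
        forall x, x = dot d1 x *: e1 + dot d2 x *: e2 + dot d3 x *: e3].
Proof.
move=> /regular_pentagon_coords[c [e1 [e2 [ka [ka0 ka2 free vE]]]]] av.
have [|d1 [d2 [d3 [dE xE]]]] := @rV3_coords R e1 e2 (a - c).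
  move=> y1 y2 y3 y0; have [y30|y30] := eqVneq y3 0.
    by move: y0; rewrite y30 scale0r addr0 => /free[].
  (* A relation with [y3] nonzero would express [a - c] through [e1] and [e2], putting the apex in
     the base plane. *)
  case: av; have := base_plane_pt (a - c) ka2 vE (- (y1 / y3)) (- (y2 / y3)).
  congr (base_plane v _); rewrite /pt scale0r addr0.
  have -> : a = c + y3^-1 *: (y3 *: (a - c)) by rewrite scalerA mulVf// scale1r addrC subrK.
  have -> : y3 *: (a - c) = - (y1 *: e1 + y2 *: e2).
    by apply/eqP; rewrite -addr_eq0 addrC y0.
  by rewrite scalerN scalerDr opprD !scalerA !scaleNr ![_^-1 * _]mulrC.
exists c, e1, e2, (a - c), d1, d2, d3, ka; split => //.
by rewrite addrC subrK.
Qed.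

Unset Implicit Arguments.

Theorem mainTheorem10 (R : realType) (a : 'rV[R]_3) (v : 'I_5 -> 'rV[R]_3)
    (v_regular : regular_pentagon v) (a_off_base : ~ base_plane v a) :
  let h := pyramid_plane a v in
  let A := pyramid_arr a v in
  let Ah6 := arr_restriction A (h 6%N) in
  let A' := A `\ h 6%N in
  let R0 := pyramid_interior a v in
  let orderA :=
    @region_ordering R 3 setT A h R0 strings38 38 in
  let orderAh6 :=
    @region_ordering R 3 (h 6%N) Ah6 (fun i => h 6%N `&` h i)
      (pentagon_interior v) strings16 16 in
  let orderA' :=
    @region_ordering R 3 setT A' h R0 strings22 22 in
  [/\ regions setT A R0,
      Ah6 = pentagon_arr v /\ regions (h 6%N) Ah6 (pentagon_interior v),
      [/\ exists r, orderA r, exists r, orderAh6 r & exists r, orderA' r] &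
      forall r rh6 r', orderA r -> orderAh6 rh6 -> orderA' r' ->
        let V := varchenko setT A r in
        [/\ P_mx *m V *m P_mx^T =
              (block_mx ((1 - 'X ^+ 2) *: varchenko (h 6%N) Ah6 rh6) 0
                        0 (varchenko setT A' r') : 'M[{poly int}]_(16 + 22)),
            varchenko setT A' r' = V22_mx &
            is_smith_normal_form V D_mx
              (W_mx *m L_mx *m T_mx *m P_mx)
              ((T_mx *m P_mx)^T *m R_mx *m W_mx^T)]].
Proof.
have [c [e1 [e2 [e3 [d1 [d2 [d3 [ka [[ka0 ka2] vE aE dE xE]]]]]]]]] :=
  pyramid_coords v_regular a_off_base.
have [_ R0 exA VA] := pyramid_arrangement ka0 ka2 vE aE dE xE.
have [Ah6E [R16 ex16 V16]] := pentagon_arrangement ka0 ka2 vE aE dE xE.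
have [ex22 V22] := cone_arrangement ka0 ka2 vE aE dE xE.
move=> h A Ah6 A' P0 orderA orderAh6 orderA'; split => //.
move=> r rh6 r' /VA rE /V16 rh6E /V22 r'E V.
rewrite /V rE rh6E r'E; split.
- exact: string_mx_deletion_restriction.
- exact: string_mx22.
- exact: string_mx_smith_normal_form.
Qed.
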